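(* Let $\Delta=\{z\in\mathbb{C}:|z|<1\}$, let $X=\Delta\times\mathbb{C}$, and let $D\subset X$ be an infinite discrete subset. Then $D$ is tame if and only if the set $\pi_1(D)=\{z\in\Delta:\exists w\in\mathbb{C},\ (z,w)\in D\}$ is discrete in $\Delta$ and for every $p\in\Delta$ the set $\{(z,w)\in D: z=p\}$ is finite.
   Context: A discrete subset of a complex manifold $X$ is a subset without accumulation points in $X$. An automorphism of $X$ is a biholomorphic self-map of $X$. An exhaustion function on $X$ is a continuous function $\rho:X\to\mathbb{R}^+$ (non-negative reals) all of whose sublevel sets $\{x\in X:\rho(x)\le c\}$ are compact. An infinite discrete subset $D\subset X$ is called tame if for every exhaustion function $\rho:X\to\mathbb{R}^+$ and every map $\zeta:D\to\mathbb{R}^+$ there exists an automorphism $\phi$ of $X$ such that $\rho(\phi(x))\ge\zeta(x)$ for all $x\in D$. *)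

(* Defs.v *)
From Stdlib Require Import Reals List Finite_sets.
From Coquelicot Require Import Coquelicot.

Open Scope R_scope.

(** The complex manifolds considered are open subsets [X] of a normed complex
    vector space [V], given as predicates.  Maps defined on [X] are represented
    by total functions on [V], whose values outside [X] are irrelevant.  As [X]
    is open, continuity and complex differentiability in the ambient space at
    the points of [X] are the same as on the manifold [X]. *)

Definition accumulation_point {V : UniformSpace} (D : V -> Prop) (x : V) : Prop :=
  forall N : V -> Prop, locally x N -> exists y : V, N y /\ y <> x /\ D y.

Definition discrete_in {V : UniformSpace} (X D : V -> Prop) : Prop :=
  (forall x, D x -> X x) /\
  (forall x, X x -> ~ accumulation_point D x).

Definition finite_set {T : Type} (A : T -> Prop) : Prop := Finite_sets.Finite T A.

(** Coquelicot has no compactness for a general [UniformSpace], and that of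
    Stdlib is for subsets of [R] only. *)
Definition compact_set {V : UniformSpace} (A : V -> Prop) : Prop :=
  forall (I : Type) (U : I -> V -> Prop),
    (forall i, open (U i)) ->
    (forall x, A x -> exists i, U i x) ->
    exists l : list I, forall x, A x -> exists i, In i l /\ U i x.

(** Over [C_AbsRing] the differential is required to be [C]-linear. *)
Definition holomorphic_on {V W : NormedModule C_AbsRing}
    (X : V -> Prop) (f : V -> W) : Prop :=
  forall x, X x -> ex_filterdiff f (locally x).

Definition automorphism {V : NormedModule C_AbsRing}
    (X : V -> Prop) (phi : V -> V) : Prop :=
  (forall x, X x -> X (phi x)) /\
  holomorphic_on X phi /\
  exists psi : V -> V,
    (forall x, X x -> X (psi x)) /\
    holomorphic_on X psi /\
    (forall x, X x -> psi (phi x) = x) /\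
    (forall x, X x -> phi (psi x) = x).

Definition exhaustion {V : UniformSpace} (X : V -> Prop) (rho : V -> R) : Prop :=
  (forall x, X x -> 0 <= rho x) /\
  (forall x, X x -> continuous rho x) /\
  (forall c : R, compact_set (fun x => X x /\ rho x <= c)).

Definition tame {V : NormedModule C_AbsRing} (X D : V -> Prop) : Prop :=
  ~ finite_set D /\
  discrete_in X D /\
  forall rho : V -> R, exhaustion X rho ->
  forall zeta : V -> R, (forall x, D x -> 0 <= zeta x) ->
  exists phi : V -> V,
    automorphism X phi /\ forall x, D x -> zeta x <= rho (phi x).

Definition C2 : NormedModule C_AbsRing :=
  prod_NormedModule C_AbsRing C_NormedModule C_NormedModule.

Definition unit_disc (z : C) : Prop := Cmod z < 1.

Definition disc_times_C (x : C2) : Prop := unit_disc (fst x).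

Definition proj1_set (D : C2 -> Prop) (z : C) : Prop :=
  unit_disc z /\ exists w : C, D (z, w).

(* Main.v *)
Require Import Defs.
From Stdlib Require Import Reals Lra Lia List Classical ClassicalEpsilon.
From Stdlib Require Import FunctionalExtensionality PropExtensionality.
From Coquelicot Require Import Coquelicot.

(** Necessity rests on a description of the automorphisms [phi] of the product
    of the disc with the plane. On a vertical line, the first coordinate of
    [phi] is a bounded entire function of [w], hence constant ([liouville]).
    The second coordinate is then an entire function with an entire left
    inverse, provided by the inverse automorphism, hence affine
    ([entire_left_inverse_affine]). So [phi] grows at most linearly in [w],
    locally uniformly in [z]. Comparing the exhaustion
    [|w| + 1 / (1 - |z|)] with the prescribed values [|w| ^ 2] shows that, for
    tame [D], the points of [D] above a neighbourhood of any [p] in the disc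
    have bounded [w] ([tame_vertically_bounded]). By discreteness they are
    finite in number, which gives both conditions.

    For sufficiency, shears [(z, w) |-> (z, w + f z)] are enough. Any
    exhaustion tends to infinity along a vertical line, so it suffices that
    [f] is holomorphic on the disc and that [|f|] exceeds a prescribed bound at
    each point of the discrete projection of [D]. Such an [f] is a series of
    monomials ([holomorphic_large_on_discrete]): each annulus contains finitely
    many of the points, and a monomial of high degree, suitably scaled, is
    large at all of them and negligible on the smaller disc.

    Holomorphy is mere complex differentiability here, so the theory of entire
    functions starts from Goursat's theorem ([goursat]). The substitution
    [w = a + exp z] turns circles with centre [a] into vertical segments, on
    which integrals of a periodic entire function do not depend on the
    abscissa; letting the radius tend to [0] yields the Cauchy estimate
    ([cauchy_estimate]). Finite differences then lower the order of growth of
    an entire function, and lead from Liouville's theorem to the fact that an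
    entire function of quadratic growth is a polynomial of degree at most two.
    Applied to [z ^ 2 / (f z - f 0)] this shows that an entire function [f]
    with an entire left inverse is affine. *)

(** * Complex derivatives *)

(** Turns the filter of the definition into an epsilon-delta statement in the
    norm, which avoids the distinct but equivalent uniform structures carried
    by [C]. *)
Lemma filterdiff_locally_iff {K : AbsRing} {U V : NormedModule K}
    (f l : U -> V) (x : U) (Hl : is_linear l) :
  filterdiff f (locally x) l <->
  forall eps : R, 0 < eps -> exists delta : R, 0 < delta /\
    forall y, norm (minus y x) < delta ->
      norm (minus (minus (f y) (f x)) (l (minus y x)))
        <= eps * norm (minus y x).
Proof.
  split.
  - intros [_ H] eps He.
    specialize (H x (fun P HP => HP) (mkposreal eps He)).
    destruct (locally_norm_le_locally x _ H) as [d Hd]. exists d. split; [apply cond_pos|].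
    intros y Hy. exact (Hd y Hy).
  - intros H. split; [exact Hl|]. intros x' Hx' eps.
    apply is_filter_lim_locally_unique in Hx'. subst x'.
    apply locally_le_locally_norm.
    destruct (H eps (cond_pos eps)) as [d [Hd Hy]].
    exists (mkposreal d Hd). exact Hy.
Qed.

(** The codomain is [C] as a module over itself with the structure for which
    the product and chain rules of [is_derive] are stated. *)
Definition Cderiv (f : C -> C) (z l : C) : Prop :=
  @is_derive C_AbsRing (AbsRing_NormedModule C_AbsRing) f z l.

Lemma Cderiv_iff (f : C -> C) (z l : C) :
  Cderiv f z l <->
  forall eps : R, 0 < eps -> exists delta : R, 0 < delta /\
    forall h, Cmod h < delta ->
      Cmod (f (z + h) - f z - h * l)%C <= eps * Cmod h.
Proof.
  unfold Cderiv, is_derive.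
  rewrite filterdiff_locally_iff by apply is_linear_scal_l.
  split; intros H eps He; destruct (H eps He) as [d [Hd Hy]]; exists d;
    (split; [exact Hd|]).
  - intros h Hh. specialize (Hy (z + h)%C).
    change (Cmod (z + h - z) < d ->
      Cmod (f (z + h) - f z - (z + h - z) * l) <= eps * Cmod (z + h - z))%C in Hy.
    replace (z + h - z)%C with h in Hy by ring. now apply Hy.
  - intros y. change (Cmod (y - z) < d ->
      Cmod (f y - f z - (y - z) * l) <= eps * Cmod (y - z))%C.
    intros Hyz. specialize (Hy (y - z)%C Hyz).
    assert (E : @eq C (z + (y - z))%C y) by ring. rewrite E in Hy. exact Hy.
Qed.

Lemma Cderiv_ext (f g : C -> C) (z l l' : C) :
  (forall w, f w = g w) -> l = l' -> Cderiv f z l -> Cderiv g z l'.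
Proof.
  intros Hfg <- H. exact (@is_derive_ext C_AbsRing (AbsRing_NormedModule C_AbsRing) f g z l Hfg H).
Qed.

Lemma Cderiv_const (c z : C) : Cderiv (fun _ => c) z 0.
Proof. exact (@is_derive_const C_AbsRing (AbsRing_NormedModule C_AbsRing) c z). Qed.

Lemma Cderiv_id (z : C) : Cderiv (fun w => w) z 1.
Proof. exact (@is_derive_id C_AbsRing z). Qed.

Lemma Cderiv_plus (f g : C -> C) (z k l : C) :
  Cderiv f z k -> Cderiv g z l -> Cderiv (fun w => f w + g w)%C z (k + l)%C.
Proof. exact (@is_derive_plus C_AbsRing (AbsRing_NormedModule C_AbsRing) f g z k l). Qed.

Lemma Cderiv_minus (f g : C -> C) (z k l : C) :
  Cderiv f z k -> Cderiv g z l -> Cderiv (fun w => f w - g w)%C z (k - l)%C.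
Proof. exact (@is_derive_minus C_AbsRing (AbsRing_NormedModule C_AbsRing) f g z k l). Qed.

Lemma Cderiv_mult (f g : C -> C) (z k l : C) :
  Cderiv f z k -> Cderiv g z l ->
  Cderiv (fun w => f w * g w)%C z (k * g z + f z * l)%C.
Proof.
  intros Hf Hg.
  exact (@is_derive_mult C_AbsRing f g z k l Hf Hg Cmult_comm).
Qed.

Lemma Cderiv_comp (f g : C -> C) (z k l : C) :
  Cderiv f (g z) k -> Cderiv g z l -> Cderiv (fun w => f (g w)) z (l * k)%C.
Proof. exact (@is_derive_comp C_AbsRing (AbsRing_NormedModule C_AbsRing) f g z k l). Qed.

Lemma Cderiv_shift (f : C -> C) (c z l : C) :
  Cderiv f (c + z)%C l -> Cderiv (fun w => f (c + w)%C) z l.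
Proof.
  intros H. refine (Cderiv_ext _ _ z (1 * l)%C l (fun w => eq_refl) _ _); [ring|].
  apply (Cderiv_comp f (fun w => c + w)%C); [exact H|].
  refine (Cderiv_ext _ _ z (0 + 1)%C _ (fun w => eq_refl) _ _); [ring|].
  apply (Cderiv_plus (fun _ => c) (fun w => w)).
  - apply Cderiv_const.
  - apply Cderiv_id.
Qed.

Lemma Cmod_triangle_inv (x y : C) : Cmod x - Cmod y <= Cmod (x + y).
Proof.
  pose proof (Cmod_triangle (x + y) (- y)) as H.
  rewrite Cmod_opp in H. replace (x + y + - y)%C with x in H by ring. lra.
Qed.

Lemma Cmod_triangle_minus (x y : C) : Cmod (x - y) <= Cmod x + Cmod y.
Proof. rewrite <- (Cmod_opp y). apply Cmod_triangle. Qed.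

Lemma Cderiv_continuous (f : C -> C) (z l : C) :
  Cderiv f z l ->
  forall eps, 0 < eps -> exists delta, 0 < delta /\
    forall h, Cmod h < delta -> Cmod (f (z + h) - f z)%C < eps.
Proof.
  intros H eps He. destruct (proj1 (Cderiv_iff f z l) H 1 Rlt_0_1) as [d [Hd Hf]].
  pose proof (Cmod_ge_0 l) as Hl.
  exists (Rmin d (eps / (2 + Cmod l))).
  assert (0 < eps / (2 + Cmod l)) by (apply Rdiv_lt_0_compat; lra).
  split; [now apply Rmin_pos|]. intros h Hh.
  pose proof (Rmin_l d (eps / (2 + Cmod l))).
  pose proof (Rmin_r d (eps / (2 + Cmod l))).
  specialize (Hf h ltac:(lra)).
  replace (f (z + h) - f z)%C with ((f (z + h) - f z - h * l) + h * l)%C by ring.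
  eapply Rle_lt_trans; [apply Cmod_triangle|]. rewrite Cmod_mult.
  pose proof (Cmod_ge_0 h).
  apply Rle_lt_trans with ((1 + Cmod l) * Cmod h); [nra|].
  apply Rle_lt_trans with ((1 + Cmod l) * (eps / (2 + Cmod l))).
  - apply Rmult_le_compat_l; lra.
  - apply Rlt_le_trans with ((2 + Cmod l) * (eps / (2 + Cmod l))).
    + apply Rmult_lt_compat_r; lra.
    + right. field. lra.
Qed.

Lemma Cderiv_inv (z : C) : z <> 0 -> Cderiv Cinv z (- / (z * z))%C.
Proof.
  intros Hz. apply Cderiv_iff. intros eps He.
  pose proof (proj1 (Cmod_gt_0 z) Hz) as Hm.
  set (m := Cmod z) in *.
  assert (Hb : 0 < eps * (m * m * m) / 2).
  { apply Rdiv_lt_0_compat; [|lra]. apply Rmult_lt_0_compat; [lra|].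
    repeat apply Rmult_lt_0_compat; lra. }
  exists (Rmin (m / 2) (eps * (m * m * m) / 2)).
  split; [apply Rmin_pos; lra|]. intros h Hh.
  pose proof (Rmin_l (m / 2) (eps * (m * m * m) / 2)).
  pose proof (Rmin_r (m / 2) (eps * (m * m * m) / 2)).
  pose proof (Cmod_triangle_inv z h) as Ht. fold m in Ht.
  assert (Hzh : (z + h)%C <> 0).
  { intros E. rewrite E, Cmod_0 in Ht. lra. }
  replace (/ (z + h) - / z - h * - / (z * z))%C with (h * (h / ((z + h) * (z * z))))%C
    by (field; auto).
  rewrite Cmod_mult, (Rmult_comm eps).
  apply Rmult_le_compat_l; [apply Cmod_ge_0|].
  rewrite Cmod_div by (repeat apply Cmult_neq_0; auto).
  rewrite !Cmod_mult. fold m.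
  apply Rle_div_l.
  - apply Rmult_gt_0_compat; [lra|]. apply Rmult_gt_0_compat; lra.
  - apply Rle_trans with (eps * (m * m * m) / 2); [lra|].
    assert (0 < m * m) by (apply Rmult_lt_0_compat; lra).
    assert (m / 2 * (m * m) <= Cmod (z + h) * (m * m)).
    { apply Rmult_le_compat_r; lra. }
    nra.
Qed.

Definition entire (f : C -> C) : Prop := forall z, exists l, Cderiv f z l.

(** * Integrals along segments *)

Lemma continuous_eps_C (f : R -> C) (t : R) :
  (forall eps, 0 < eps -> exists delta, 0 < delta /\
    forall s, Rabs (s - t) < delta -> Cmod (f s - f t)%C < eps) ->
  continuous (U := C_R_CompleteNormedModule) f t.
Proof.
  intros H P [eps HP]. destruct (H eps (cond_pos eps)) as [d [Hd Hs]].
  exists (mkposreal d Hd). intros s Hst. apply HP.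
  apply C_NormedModule_mixin_compat1. exact (Hs s Hst).
Qed.

Lemma entire_segment_continuous (f : C -> C) (p d : C) (t : R) :
  entire f -> continuous (U := C_R_CompleteNormedModule) (fun s : R => f (p + s * d)%C) t.
Proof.
  intros Hf. apply continuous_eps_C. intros eps He.
  destruct (Hf (p + t * d)%C) as [l Hl].
  destruct (Cderiv_continuous _ _ _ Hl eps He) as [del [Hdel H]].
  pose proof (Cmod_ge_0 d) as Hd.
  exists (del / (1 + Cmod d)). split; [apply Rdiv_lt_0_compat; lra|].
  intros s Hs.
  replace (p + s * d)%C with (p + t * d + (s - t)%R * d)%C
    by (rewrite RtoC_minus; ring).
  apply H. rewrite Cmod_mult, Cmod_R.
  apply Rlt_div_r in Hs; [|lra]. pose proof (Rabs_pos (s - t)). nra.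
Qed.

(** The average of [f] over the segment from [p] to [p + d]; the integral of
    [f (z) dz] along it is [d * mean f p d]. *)
Definition mean (f : C -> C) (p d : C) : C :=
  RInt (V := C_R_CompleteNormedModule) (fun t : R => f (p + t * d)%C) 0 1.

Lemma mean_is_RInt (f : C -> C) (p d : C) : entire f ->
  is_RInt (V := C_R_CompleteNormedModule) (fun t : R => f (p + t * d)%C) 0 1 (mean f p d).
Proof.
  intros Hf. apply (RInt_correct (V := C_R_CompleteNormedModule)).
  apply ex_RInt_continuous. intros t _. now apply entire_segment_continuous.
Qed.

Lemma mean_unique (f : C -> C) (p d m : C) :
  is_RInt (V := C_R_CompleteNormedModule) (fun t : R => f (p + t * d)%C) 0 1 m ->
  mean f p d = m.
Proof. intros H. exact (is_RInt_unique (V := C_R_CompleteNormedModule) _ _ _ _ H). Qed.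

Lemma mean_minus (f g : C -> C) (p d : C) : entire f -> entire g ->
  mean (fun z => f z - g z)%C p d = (mean f p d - mean g p d)%C.
Proof.
  intros Hf Hg. apply mean_unique.
  exact (is_RInt_minus (V := C_R_CompleteNormedModule) _ _ 0 1 _ _
           (mean_is_RInt f p d Hf) (mean_is_RInt g p d Hg)).
Qed.

Lemma mean_bound (f : C -> C) (p d : C) (M : R) : entire f ->
  (forall t, 0 <= t <= 1 -> Cmod (f (p + t * d)%C) <= M) -> Cmod (mean f p d) <= M.
Proof.
  intros Hf HM. replace M with ((1 - 0) * M) by ring. rewrite Cmod_norm.
  apply (norm_RInt_le_const (V := C_R_NormedModule) (fun t : R => f (p + t * d)%C) 0 1).
  - lra.
  - intros t Ht. rewrite <- Cmod_norm. now apply HM.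
  - exact (mean_is_RInt f p d Hf).
Qed.

Lemma is_RInt_R_C (g : R -> R) (c : C) (a b m : R) :
  is_RInt g a b m ->
  is_RInt (V := C_R_NormedModule) (fun t => (g t * c)%C) a b (m * c)%C.
Proof.
  intros H.
  assert (E : forall s : R, (s * c)%C = (s * fst c, s * snd c)).
  { intros s. unfold Cmult. simpl. f_equal; ring. }
  rewrite E.
  apply is_RInt_fct_extend_pair.
  - apply (is_RInt_ext (fun t => scal (fst c) (g t))).
    + intros t _. rewrite E. simpl. unfold scal; simpl; unfold mult; simpl. ring.
    + replace (m * fst c) with (scal (fst c) m) by (unfold scal; simpl; unfold mult; simpl; ring).
      now apply (is_RInt_scal (V := R_NormedModule)).
  - apply (is_RInt_ext (fun t => scal (snd c) (g t))).
    + intros t _. rewrite E. simpl. unfold scal; simpl; unfold mult; simpl. ring.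
    + replace (m * snd c) with (scal (snd c) m) by (unfold scal; simpl; unfold mult; simpl; ring).
      now apply (is_RInt_scal (V := R_NormedModule)).
Qed.

Lemma mean_affine (A B p d : C) :
  mean (fun z => A + B * z)%C p d = (A + B * p + B * d / 2)%C.
Proof.
  apply mean_unique.
  replace (A + B * p + B * d / 2)%C with (1%R * (A + B * p) + (1 / 2)%R * (B * d))%C.
  2:{ rewrite RtoC_div by lra. field. }
  apply (is_RInt_ext (V := C_R_NormedModule)
          (fun t : R => plus (1%R * (A + B * p))%C (t * (B * d))%C)).
  - intros t _. change (1 * (A + B * p) + t * (B * d) = A + B * (p + t * d))%C. ring.
  - apply (is_RInt_plus (V := C_R_NormedModule)).
    + apply is_RInt_R_C.
      replace 1 with (scal (1 - 0) 1) at 2 by (unfold scal; simpl; unfold mult; simpl; ring).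
      apply (is_RInt_const (V := R_NormedModule)).
    + apply is_RInt_R_C.
      replace (1 / 2) with (minus (1 ^ 2 / 2) (0 ^ 2 / 2))
        by (unfold minus, plus, opp; simpl; lra).
      apply (is_RInt_derive (V := R_CompleteNormedModule) (fun t => t ^ 2 / 2) (fun t => t)).
      * intros t _. auto_derive; [trivial|]. field.
      * intros t _. apply continuous_id.
Qed.

(** Linear substitution on each half of the parameter interval; this is what
    makes contour integrals additive under subdivision. *)
Lemma mean_halve (f : C -> C) (p d : C) : entire f ->
  (2 * mean f p d)%C = (mean f p (d / 2) + mean f (p + d / 2) (d / 2))%C.
Proof.
  intros Hf.
  set (F := fun t : R => scal 2 (f (p + t * d)%C : C_R_NormedModule)).
  assert (H : is_RInt (V := C_R_NormedModule) F 0 1 (scal 2 (mean f p d : C_R_NormedModule))).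
  { apply (is_RInt_scal (V := C_R_NormedModule)). now apply mean_is_RInt. }
  assert (H1 : is_RInt (V := C_R_NormedModule) F 0 (1 / 2) (mean f p (d / 2)%C)).
  { apply (is_RInt_ext (V := C_R_NormedModule)
      (fun t => scal 2 (f (p + (2 * t + 0)%R * (d / 2))%C : C_R_NormedModule))).
    { intros t _. unfold F. do 2 f_equal.
      rewrite RtoC_plus, RtoC_mult. field. }
    apply (is_RInt_comp_lin (V := C_R_NormedModule) (fun s : R => f (p + s * (d / 2))%C)).
    replace (2 * 0 + 0) with 0 by ring. replace (2 * (1 / 2) + 0) with 1 by field.
    now apply mean_is_RInt. }
  assert (H3 : is_RInt (V := C_R_NormedModule) F (1 / 2) 1 (mean f (p + d / 2)%C (d / 2)%C)).
  { apply (is_RInt_ext (V := C_R_NormedModule)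
      (fun t => scal 2 (f (p + d / 2 + (2 * t + -1)%R * (d / 2))%C : C_R_NormedModule))).
    { intros t _. unfold F. do 2 f_equal.
      rewrite RtoC_plus, RtoC_mult. field. }
    apply (is_RInt_comp_lin (V := C_R_NormedModule)
             (fun s : R => f (p + d / 2 + s * (d / 2))%C)).
    replace (2 * (1 / 2) + -1) with 0 by field. replace (2 * 1 + -1) with 1 by ring.
    now apply mean_is_RInt. }
  pose proof (is_RInt_Chasles (V := C_R_NormedModule) F _ _ _ _ _ H1 H3) as H4.
  rewrite <- scal_R_Cmult.
  transitivity (RInt (V := C_R_CompleteNormedModule) F 0 1).
  - symmetry. exact (is_RInt_unique (V := C_R_CompleteNormedModule) _ _ _ _ H).
  - exact (is_RInt_unique (V := C_R_CompleteNormedModule) _ _ _ _ H4).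
Qed.

(** * Goursat's theorem *)

Definition side (f : C -> C) (p d : C) : C := (d * mean f p d)%C.

(** The integral of [f (z) dz] around the parallelogram with corner [p] and
    sides [u], [v]. Allowing arbitrary complex sides makes the formulas
    independent of real and imaginary parts. *)
Definition contour (f : C -> C) (p u v : C) : C :=
  (side f p u + side f (p + u) v - side f (p + v) u - side f p v)%C.

Lemma side_halve (f : C -> C) (p d : C) : entire f ->
  side f p d = (side f p (d / 2) + side f (p + d / 2) (d / 2))%C.
Proof.
  intros Hf. unfold side.
  transitivity (d / 2 * (2 * mean f p d))%C; [field|].
  rewrite mean_halve by exact Hf. ring.
Qed.

(** The contributions of the inner sides cancel. *)
Lemma contour_quarter (f : C -> C) (p u v : C) : entire f ->
  contour f p u v =
    (contour f p (u / 2) (v / 2) + contour f (p + u / 2) (u / 2) (v / 2)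
     + contour f (p + v / 2) (u / 2) (v / 2)
     + contour f (p + u / 2 + v / 2) (u / 2) (v / 2))%C.
Proof.
  intros Hf. unfold contour.
  rewrite (side_halve f p u), (side_halve f (p + u) v),
    (side_halve f (p + v) u), (side_halve f p v) by exact Hf.
  replace (p + u / 2 + u / 2)%C with (p + u)%C by field.
  replace (p + v / 2 + v / 2)%C with (p + v)%C by field.
  replace (p + u / 2 + v / 2 + u / 2)%C with (p + u + v / 2)%C by field.
  replace (p + u / 2 + v / 2 + v / 2)%C with (p + v + u / 2)%C by field.
  replace (p + v / 2 + u / 2)%C with (p + u / 2 + v / 2)%C by ring.
  ring.
Qed.

(** An affine function has a primitive, so its integral around a closed
    contour vanishes. *)
Lemma contour_affine (A B p u v : C) : contour (fun z => A + B * z)%C p u v = 0.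
Proof. unfold contour, side. rewrite !mean_affine. field. Qed.

Lemma entire_affine (A B : C) : entire (fun z => A + B * z)%C.
Proof.
  intros z. eexists. apply (Cderiv_plus (fun _ => A)).
  - apply Cderiv_const.
  - apply (Cderiv_mult (fun _ => B)); [apply Cderiv_const|apply Cderiv_id].
Qed.

Lemma entire_minus (f g : C -> C) :
  entire f -> entire g -> entire (fun z => f z - g z)%C.
Proof.
  intros Hf Hg z. destruct (Hf z) as [k Hk]. destruct (Hg z) as [l Hl].
  exists (k - l)%C. now apply Cderiv_minus.
Qed.

Lemma contour_bound (f : C -> C) (p u v : C) (M : R) : entire f ->
  (forall s t, 0 <= s <= 1 -> 0 <= t <= 1 -> Cmod (f (p + s * u + t * v)%C) <= M) ->
  Cmod (contour f p u v) <= 2 * (Cmod u + Cmod v) * M.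
Proof.
  intros Hf HM.
  assert (Hs : forall q d, (forall t, 0 <= t <= 1 -> Cmod (f (q + t * d)%C) <= M) ->
    Cmod (side f q d) <= Cmod d * M).
  { intros q d Hq. unfold side. rewrite Cmod_mult.
    apply Rmult_le_compat_l; [apply Cmod_ge_0|]. now apply mean_bound. }
  assert (H1 : Cmod (side f p u) <= Cmod u * M).
  { apply Hs. intros t Ht. specialize (HM t 0 Ht ltac:(lra)).
    now replace (p + t * u + 0 * v)%C with (p + t * u)%C in HM by ring. }
  assert (H2 : Cmod (side f (p + u) v) <= Cmod v * M).
  { apply Hs. intros t Ht. specialize (HM 1 t ltac:(lra) Ht).
    now replace (p + 1 * u + t * v)%C with (p + u + t * v)%C in HM by ring. }
  assert (H3 : Cmod (side f (p + v) u) <= Cmod u * M).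
  { apply Hs. intros t Ht. specialize (HM t 1 Ht ltac:(lra)).
    now replace (p + t * u + 1 * v)%C with (p + v + t * u)%C in HM by ring. }
  assert (H4 : Cmod (side f p v) <= Cmod v * M).
  { apply Hs. intros t Ht. specialize (HM 0 t ltac:(lra) Ht).
    now replace (p + 0 * u + t * v)%C with (p + t * v)%C in HM by ring. }
  unfold contour.
  pose proof (Cmod_triangle_minus (side f p u + side f (p + u) v - side f (p + v) u) (side f p v)).
  pose proof (Cmod_triangle_minus (side f p u + side f (p + u) v) (side f (p + v) u)).
  pose proof (Cmod_triangle (side f p u) (side f (p + u) v)).
  lra.
Qed.

(** The bisection step: by the triangle inequality one of the four quarters
    carries at least a quarter of the contour integral. *)
Lemma quarter_choice (f : C -> C) (p u v : C) : entire f ->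
  exists q, Cmod (q - p) <= (Cmod u + Cmod v) / 2 /\
    Cmod (contour f p u v) <= 4 * Cmod (contour f q (u / 2) (v / 2)).
Proof.
  intros Hf. rewrite (contour_quarter f p u v Hf).
  assert (Hh : forall w, Cmod (w / 2) = Cmod w / 2).
  { intros w. rewrite Cmod_div, Cmod_R, Rabs_right; [reflexivity|lra|].
    intros E; apply RtoC_inj in E; lra. }
  set (a := contour f p (u / 2) (v / 2)).
  set (b := contour f (p + u / 2) (u / 2) (v / 2)).
  set (c := contour f (p + v / 2) (u / 2) (v / 2)).
  set (d := contour f (p + u / 2 + v / 2) (u / 2) (v / 2)).
  pose proof (Cmod_triangle (a + b + c) d).
  pose proof (Cmod_triangle (a + b) c). pose proof (Cmod_triangle a b).
  pose proof (Cmod_ge_0 u). pose proof (Cmod_ge_0 v).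
  assert (Hor : Cmod (a + b + c + d) <= 4 * Cmod a \/ Cmod (a + b + c + d) <= 4 * Cmod b \/
    Cmod (a + b + c + d) <= 4 * Cmod c \/ Cmod (a + b + c + d) <= 4 * Cmod d) by lra.
  destruct Hor as [Ho|[Ho|[Ho|Ho]]].
  - exists p. split; [|exact Ho]. replace (p - p)%C with (RtoC 0) by ring. rewrite Cmod_0. lra.
  - exists (p + u / 2)%C. split; [|exact Ho].
    replace (p + u / 2 - p)%C with (u / 2)%C by ring. rewrite Hh. lra.
  - exists (p + v / 2)%C. split; [|exact Ho].
    replace (p + v / 2 - p)%C with (v / 2)%C by ring. rewrite Hh. lra.
  - exists (p + u / 2 + v / 2)%C. split; [|exact Ho].
    replace (p + u / 2 + v / 2 - p)%C with (u / 2 + v / 2)%C by ring.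
    pose proof (Cmod_triangle (u / 2) (v / 2)) as Ht. rewrite !Hh in Ht. lra.
Qed.

(** The intervals with centre [x n] and radius [K / 2 ^ n] are nested. *)
Lemma dyadic_limit_R (x : nat -> R) (K : R) :
  (forall n, Rabs (x (S n) - x n) <= K * (/ 2) ^ (S n)) ->
  exists c, forall n, Rabs (x n - c) <= K * (/ 2) ^ n.
Proof.
  intros H.
  assert (HK : 0 <= K).
  { specialize (H 0%nat). pose proof (Rabs_pos (x 1%nat - x 0%nat)). simpl in H. lra. }
  set (lo := fun n => x n - K * (/ 2) ^ n). set (hi := fun n => x n + K * (/ 2) ^ n).
  assert (Hlo : forall n, lo n <= lo (S n)).
  { intros n. unfold lo. specialize (H n). apply Rabs_le_between in H. simpl in *. lra. }
  assert (Hhi : forall n, hi (S n) <= hi n).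
  { intros n. unfold hi. specialize (H n). apply Rabs_le_between in H. simpl in *. lra. }
  assert (Hlh : forall n, lo n <= hi n).
  { intros n. unfold lo, hi. assert (0 <= (/ 2) ^ n) by (apply pow_le; lra). nra. }
  assert (Hd : is_lim_seq (fun n => hi n - lo n) 0).
  { unfold lo, hi. apply (is_lim_seq_ext (fun n => 2 * K * (/ 2) ^ n)); [intros n; ring|].
    replace (Finite 0) with (Rbar_mult (2 * K) 0) by (simpl; f_equal; ring).
    apply is_lim_seq_scal_l, is_lim_seq_geom. rewrite Rabs_right; lra. }
  destruct (ex_lim_seq_adj lo hi Hlo Hhi Hd) as [[l Hl] [[l' Hl'] E]].
  rewrite (is_lim_seq_unique _ _ Hl), (is_lim_seq_unique _ _ Hl') in E.
  injection E as <-. exists l. intros n.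
  pose proof (is_lim_seq_incr_compare lo l Hl Hlo n) as H1.
  pose proof (is_lim_seq_decr_compare hi l Hl' Hhi n) as H2.
  unfold lo, hi in H1, H2. apply Rabs_le. lra.
Qed.

Lemma dyadic_limit (x : nat -> C) (K : R) :
  (forall n, Cmod (x (S n) - x n) <= K * (/ 2) ^ (S n)) ->
  exists c, forall n, Cmod (x n - c) <= 2 * K * (/ 2) ^ n.
Proof.
  intros H.
  destruct (dyadic_limit_R (fun n => fst (x n)) K) as [c1 H1].
  { intros n. eapply Rle_trans; [|apply (H n)].
    eapply Rle_trans; [|apply Rmax_Cmod]. apply Rmax_l. }
  destruct (dyadic_limit_R (fun n => snd (x n)) K) as [c2 H2].
  { intros n. eapply Rle_trans; [|apply (H n)].
    eapply Rle_trans; [|apply Rmax_Cmod]. apply Rmax_r. }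
  exists (c1, c2). intros n.
  replace (x n - (c1, c2))%C with (RtoC (fst (x n) - c1) + RtoC (snd (x n) - c2) * Ci)%C.
  2:{ destruct (x n) as [a b]. apply injective_projections; simpl; ring. }
  eapply Rle_trans; [apply Cmod_triangle|].
  rewrite Cmod_mult, !Cmod_R, Cmod_Ci. specialize (H1 n). specialize (H2 n). simpl in *. lra.
Qed.

(** Bisection gives nested parallelograms, with sides divided by [2 ^ n],
    around each of which the integral has modulus at least [eta / 4 ^ n]. They
    shrink to a point [c], near which [f] is its affine Taylor polynomial up
    to [eps * |z - c|]. The affine part contributes nothing, and the remainder
    at most [eps] times the product of diameter and perimeter, which is of
    order [eps / 4 ^ n]: a contradiction for small [eps]. *)
Theorem goursat (f : C -> C) (p u v : C) : entire f -> contour f p u v = 0.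
Proof.
  intros Hf. apply Cmod_eq_0.
  destruct (Rle_lt_or_eq_dec 0 _ (Cmod_ge_0 (contour f p u v))) as [Heta|]; [exfalso|auto].
  set (eta := Cmod (contour f p u v)) in *.
  set (L := Cmod u + Cmod v).
  assert (Hnext : exists next : C * C * C -> C, forall q,
    Cmod (next q - fst (fst q)) <= (Cmod (snd (fst q)) + Cmod (snd q)) / 2 /\
    Cmod (contour f (fst (fst q)) (snd (fst q)) (snd q))
      <= 4 * Cmod (contour f (next q) (snd (fst q) / 2) (snd q / 2))).
  { exists (fun q => proj1_sig (constructive_indefinite_description _
      (quarter_choice f (fst (fst q)) (snd (fst q)) (snd q) Hf))).
    intros q. exact (proj2_sig (constructive_indefinite_description _
      (quarter_choice f (fst (fst q)) (snd (fst q)) (snd q) Hf))). }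
  destruct Hnext as [next Hnext].
  set (sc := fun n => RtoC ((/ 2) ^ n)).
  assert (Hsc : forall w n, (w * sc n / 2 = w * sc (S n))%C).
  { intros w n. unfold sc. simpl. rewrite RtoC_mult, RtoC_inv by lra. field. }
  assert (Hmsc : forall w n, Cmod (w * sc n) = Cmod w * (/ 2) ^ n).
  { intros w n. unfold sc. rewrite Cmod_mult, Cmod_R, Rabs_right; [reflexivity|].
    apply Rle_ge, pow_le. lra. }
  set (x := fix x n := match n with
                       | O => p
                       | S m => next (x m, (u * sc m)%C, (v * sc m)%C)
                       end).
  assert (Hx : forall n, Cmod (x (S n) - x n) <= L * (/ 2) ^ (S n)).
  { intros n. destruct (Hnext (x n, (u * sc n)%C, (v * sc n)%C)) as [H _].
    simpl fst in H; simpl snd in H. rewrite !Hmsc in H. unfold L. simpl. lra. }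
  assert (Hc : forall n, eta <= 4 ^ n * Cmod (contour f (x n) (u * sc n) (v * sc n))).
  { induction n as [|n IH].
    - simpl x. unfold sc. simpl. rewrite !Cmult_1_r. fold eta. lra.
    - destruct (Hnext (x n, (u * sc n)%C, (v * sc n)%C)) as [_ H].
      simpl fst in H; simpl snd in H. rewrite !Hsc in H.
      change (next (x n, (u * sc n)%C, (v * sc n)%C)) with (x (S n)) in H.
      assert (0 < 4 ^ n) by (apply pow_lt; lra). simpl pow. nra. }
  destruct (dyadic_limit x L Hx) as [c Hlim].
  assert (HL : 0 <= L) by (unfold L; pose proof (Cmod_ge_0 u); pose proof (Cmod_ge_0 v); lra).
  destruct (Hf c) as [l Hl].
  (* [6 * L * L] collects the diameter and perimeter constants of the bound
     [Hb]; adding [1] makes the quotient meaningful for [L = 0] and the final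
     inequality strict. *)
  set (eps := eta / (6 * L * L + 1)).
  assert (Heps : 0 < eps) by (apply Rdiv_lt_0_compat; nra).
  destruct (proj1 (Cderiv_iff f c l) Hl eps Heps) as [del [Hdel Hfc]].
  assert (Hn : exists n, 3 * L * (/ 2) ^ n < del).
  { destruct (pow_lt_1_zero (/ 2) ltac:(rewrite Rabs_right; lra) (del / (3 * L + 1))) as [N HN].
    { apply Rdiv_lt_0_compat; lra. }
    exists N. specialize (HN N (le_n N)). rewrite Rabs_right in HN by (apply Rle_ge, pow_le; lra).
    apply Rlt_div_r in HN; [|lra].
    assert (0 < (/ 2) ^ N) by (apply pow_lt; lra). lra. }
  destruct Hn as [n Hn].
  set (h := (/ 2) ^ n) in *.
  assert (Hh : 0 < h) by (apply pow_lt; lra).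
  set (aff := fun z => (f c - c * l + l * z)%C).
  assert (Haff : entire aff) by apply entire_affine.
  set (e := fun z => (f z - aff z)%C).
  assert (He : entire e) by now apply entire_minus.
  assert (Hce : contour f (x n) (u * sc n) (v * sc n) = contour e (x n) (u * sc n) (v * sc n)).
  { assert (E : forall q a b, contour e q a b = (contour f q a b - contour aff q a b)%C).
    { intros q a b. unfold contour, side, e. rewrite !mean_minus by assumption. ring. }
    rewrite E. unfold aff. rewrite contour_affine. ring. }
  assert (Hb : Cmod (contour e (x n) (u * sc n) (v * sc n)) <= 2 * (L * h) * (eps * (3 * L * h))).
  { eapply Rle_trans; [apply (contour_bound e _ _ _ (eps * (3 * L * h)) He)|].
    - intros s t Hs Ht.
      set (k := (x n + s * (u * sc n) + t * (v * sc n) - c)%C).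
      assert (Hk : Cmod k <= 3 * L * h).
      { unfold k.
        replace (x n + s * (u * sc n) + t * (v * sc n) - c)%C
          with ((x n - c) + (s * (u * sc n) + t * (v * sc n)))%C by ring.
        eapply Rle_trans; [apply Cmod_triangle|].
        pose proof (Hlim n) as H1. fold h in H1.
        pose proof (Cmod_triangle (s * (u * sc n)) (t * (v * sc n))) as H2.
        rewrite (Cmod_mult s), (Cmod_mult t), !Cmod_R, !Hmsc in H2. fold h in H2.
        rewrite !Rabs_right in H2 by lra.
        pose proof (Cmod_ge_0 u). pose proof (Cmod_ge_0 v).
        assert (s * (Cmod u * h) <= 1 * (Cmod u * h))
          by (apply Rmult_le_compat_r; [apply Rmult_le_pos|]; lra).
        assert (t * (Cmod v * h) <= 1 * (Cmod v * h))
          by (apply Rmult_le_compat_r; [apply Rmult_le_pos|]; lra).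
        unfold L in *. nra. }
      replace (x n + s * (u * sc n) + t * (v * sc n))%C with (c + k)%C by (unfold k; ring).
      unfold e, aff.
      replace (f (c + k) - (f c - c * l + l * (c + k)))%C with (f (c + k) - f c - k * l)%C by ring.
      eapply Rle_trans; [apply Hfc; lra|]. apply Rmult_le_compat_l; lra.
    - rewrite !Hmsc. fold h. unfold L. right. ring. }
  specialize (Hc n). rewrite Hce in Hc.
  assert (H4 : 4 ^ n * (h * h) = 1).
  { unfold h. rewrite <- !Rpow_mult_distr. replace (4 * (/ 2 * / 2)) with 1 by field. apply pow1. }
  assert (0 < 4 ^ n) by (apply pow_lt; lra).
  assert (Hf1 : eta <= 6 * L * L * eps).
  { eapply Rle_trans; [exact Hc|]. eapply Rle_trans; [apply Rmult_le_compat_l; [lra|exact Hb]|].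
    replace (4 ^ n * (2 * (L * h) * (eps * (3 * L * h))))
      with (6 * L * L * eps * (4 ^ n * (h * h))) by ring.
    rewrite H4. lra. }
  assert (eta = eps * (6 * L * L + 1)) by (unfold eps; field; nra).
  lra.
Qed.

(** * The complex exponential *)

Definition Cexp (z : C) : C := (exp (fst z) * cos (snd z), exp (fst z) * sin (snd z)).

Lemma Cexp_plus (z w : C) : Cexp (z + w)%C = (Cexp z * Cexp w)%C.
Proof.
  destruct z as [a b], w as [c d]. unfold Cexp, Cplus, Cmult. simpl.
  rewrite exp_plus, cos_plus, sin_plus. f_equal; ring.
Qed.

Lemma Cexp_0 : Cexp 0 = 1.
Proof. unfold Cexp. simpl. rewrite exp_0, cos_0, sin_0. unfold RtoC. f_equal; ring. Qed.

Lemma Cmod_Cexp (z : C) : Cmod (Cexp z) = exp (fst z).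
Proof.
  unfold Cmod, Cexp. simpl fst; simpl snd.
  replace ((exp (fst z) * cos (snd z)) ^ 2 + (exp (fst z) * sin (snd z)) ^ 2)
    with ((exp (fst z)) ^ 2 * ((sin (snd z))² + (cos (snd z))²)) by (unfold Rsqr; ring).
  rewrite sin2_cos2, Rmult_1_r. apply sqrt_pow2, Rlt_le, exp_pos.
Qed.

Lemma Cexp_period (z : C) : Cexp (z + (0, (2 * PI)%R))%C = Cexp z.
Proof.
  unfold Cexp. simpl. rewrite Rplus_0_r.
  replace (snd z + 2 * PI) with (snd z + 2 * INR 1 * PI) by (simpl; ring).
  now rewrite cos_period, sin_period.
Qed.

Lemma Cmod_le_plus (a b : R) : Cmod (a, b) <= Rabs a + Rabs b.
Proof.
  replace (a, b) with (RtoC a + RtoC b * Ci)%C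
    by (apply injective_projections; simpl; ring).
  eapply Rle_trans; [apply Cmod_triangle|].
  rewrite Cmod_mult, !Cmod_R, Cmod_Ci. lra.
Qed.

Lemma derivable_pt_lim_0 (f : R -> R) (l eps : R) :
  derivable_pt_lim f 0 l -> 0 < eps ->
  exists delta, 0 < delta /\
    forall h, Rabs h < delta -> Rabs (f h - f 0 - l * h) <= eps * Rabs h.
Proof.
  intros H He. destruct (H eps He) as [d Hd]. exists d. split; [apply cond_pos|].
  intros h Hh. destruct (Req_dec h 0) as [->|Hnz].
  - replace (f 0 - f 0 - l * 0) with 0 by ring. rewrite !Rabs_R0. lra.
  - specialize (Hd h Hnz Hh). rewrite Rplus_0_l in Hd.
    replace (f h - f 0 - l * h) with (((f h - f 0) / h - l) * h) by (field; exact Hnz).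
    rewrite Rabs_mult. apply Rmult_le_compat_r; [apply Rabs_pos|lra].
Qed.

(** Follows from the derivatives at [0] of [exp], [sin] and [cos], since the
    exponential splits as [exp x * cos y] and [exp x * sin y]. *)
Lemma Cderiv_Cexp_0 : Cderiv Cexp 0 1.
Proof.
  apply Cderiv_iff. intros eps0 He0.
  set (eps := Rmin 1 (eps0 / 6)).
  assert (He : 0 < eps) by (apply Rmin_pos; lra).
  assert (He1 : eps <= 1) by apply Rmin_l.
  assert (He6 : eps <= eps0 / 6) by apply Rmin_r.
  assert (Hexp : derivable_pt_lim exp 0 1) by (rewrite <- exp_0; apply derivable_pt_lim_exp).
  assert (Hsin : derivable_pt_lim sin 0 1) by (rewrite <- cos_0; apply derivable_pt_lim_sin).
  assert (Hcos : derivable_pt_lim cos 0 0).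
  { replace 0 with (- sin 0) at 2 by (rewrite sin_0; ring). apply derivable_pt_lim_cos. }
  destruct (derivable_pt_lim_0 exp 1 eps Hexp He) as [d1 [Hd1 H1]].
  destruct (derivable_pt_lim_0 sin 1 eps Hsin He) as [d2 [Hd2 H2]].
  destruct (derivable_pt_lim_0 cos 0 eps Hcos He) as [d3 [Hd3 H3]].
  exists (Rmin (Rmin d1 d2) (Rmin d3 (eps / 2))).
  split; [repeat apply Rmin_pos; lra|].
  intros [x y] Hh.
  pose proof (Rmin_l (Rmin d1 d2) (Rmin d3 (eps / 2))).
  pose proof (Rmin_r (Rmin d1 d2) (Rmin d3 (eps / 2))).
  pose proof (Rmin_l d1 d2). pose proof (Rmin_r d1 d2).
  pose proof (Rmin_l d3 (eps / 2)). pose proof (Rmin_r d3 (eps / 2)).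
  pose proof (Rmax_Cmod (x, y)) as Hm. simpl in Hm.
  pose proof (Rmax_l (Rabs x) (Rabs y)). pose proof (Rmax_r (Rabs x) (Rabs y)).
  rewrite Cplus_0_l, Cexp_0, Cmult_1_r.
  specialize (H1 x ltac:(lra)). specialize (H2 y ltac:(lra)). specialize (H3 y ltac:(lra)).
  rewrite exp_0 in H1. rewrite sin_0 in H2. rewrite cos_0 in H3.
  replace (Cexp (x, y) - 1 - (x, y))%C
    with (exp x * cos y - 1 - x, exp x * sin y - y)
    by (unfold Cexp; apply injective_projections; simpl; ring).
  eapply Rle_trans; [apply Cmod_le_plus|].
  pose proof (Rabs_pos x). pose proof (Rabs_pos y).
  assert (Hex : Rabs (exp x - 1) <= 2 * Rabs x).
  { replace (exp x - 1) with ((exp x - 1 - 1 * x) + x) by ring.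
    eapply Rle_trans; [apply Rabs_triang|].
    assert (eps * Rabs x <= 1 * Rabs x) by (apply Rmult_le_compat_r; lra). lra. }
  assert (Hex2 : Rabs (exp x) <= 2).
  { replace (exp x) with ((exp x - 1) + 1) by ring.
    eapply Rle_trans; [apply Rabs_triang|]. rewrite Rabs_R1. lra. }
  assert (Ha : Rabs (exp x * cos y - 1 - x) <= eps * Rabs x + 2 * (eps * Rabs y)).
  { replace (exp x * cos y - 1 - x)
      with ((exp x - 1 - 1 * x) + exp x * (cos y - 1 - 0 * y)) by ring.
    eapply Rle_trans; [apply Rabs_triang|]. rewrite Rabs_mult.
    apply Rplus_le_compat; [exact H1|].
    apply Rmult_le_compat; try apply Rabs_pos; assumption. }
  assert (Hb : Rabs (exp x * sin y - y) <= 2 * (eps * Rabs y) + eps * Rabs y).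
  { replace (exp x * sin y - y)
      with (exp x * (sin y - 0 - 1 * y) + (exp x - 1) * y) by ring.
    eapply Rle_trans; [apply Rabs_triang|]. rewrite !Rabs_mult.
    apply Rplus_le_compat.
    - apply Rmult_le_compat; try apply Rabs_pos; assumption.
    - apply Rmult_le_compat_r; lra. }
  assert (eps * Rabs x <= eps * Cmod (x, y)) by (apply Rmult_le_compat_l; lra).
  assert (eps * Rabs y <= eps * Cmod (x, y)) by (apply Rmult_le_compat_l; lra).
  assert (6 * eps * Cmod (x, y) <= eps0 * Cmod (x, y))
    by (apply Rmult_le_compat_r; [apply Cmod_ge_0|lra]).
  lra.
Qed.

Lemma Cderiv_Cexp (z : C) : Cderiv Cexp z (Cexp z).
Proof.
  apply (Cderiv_ext (fun w => Cexp z * Cexp (- z + w))%C _ z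
    (0 * Cexp (- z + z) + Cexp z * 1)%C).
  - intros w. rewrite <- Cexp_plus. f_equal. ring.
  - ring.
  - apply (Cderiv_mult (fun _ => Cexp z) (fun w => Cexp (- z + w)%C)); [apply Cderiv_const|].
    apply Cderiv_shift. replace (- z + z)%C with (RtoC 0) by ring. apply Cderiv_Cexp_0.
Qed.

Lemma Cderiv_opp_id (z : C) : Cderiv Copp z (- (1))%C.
Proof.
  apply (Cderiv_ext (fun w => 0 - w)%C _ z (0 - 1)%C); [intros w; ring|ring|].
  apply Cderiv_minus; [apply Cderiv_const|apply Cderiv_id].
Qed.

(** * Cauchy estimates and growth of entire functions *)

(** In Goursat's theorem for sides [u] and the period [v], the integrals along
    the two sides parallel to [u] cancel by periodicity. *)
Lemma mean_periodic (G : C -> C) (v p u : C) :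
  entire G -> (forall z, G (z + v)%C = G z) -> v <> 0 ->
  mean G (p + u) v = mean G p v.
Proof.
  intros HG Hper Hv.
  pose proof (goursat G p u v HG) as H. unfold contour in H.
  assert (E : side G (p + v) u = side G p u).
  { unfold side, mean. f_equal. apply RInt_ext. intros t _.
    rewrite <- (Hper (p + t * u)%C). f_equal. ring. }
  rewrite E in H. unfold side in H.
  assert (Hz : (v * (mean G (p + u) v - mean G p v))%C = 0) by (rewrite <- H; ring).
  apply Ceq_minus. destruct (Ceq_dec (mean G (p + u) v - mean G p v)%C 0) as [e|e]; [exact e|].
  now destruct (Cmult_neq_0 _ _ Hv e).
Qed.

(** The function [G (z) = (f (a + exp z) - f a) * exp (- z)] has period [2 i
    PI], and its mean over a vertical segment of that length is the mean of
    the difference quotient [(f w - f a) / (w - a)] over a circle with centre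
    [a]. By periodicity this mean does not depend on the radius. It is bounded
    by [M / r] on the given circle and tends to [f'(a)] when the radius tends
    to [0]. *)
Lemma cauchy_estimate (f : C -> C) (a l : C) (r M : R) :
  entire f -> Cderiv f a l -> 0 < r ->
  (forall z, Cmod (z - a) = r -> Cmod (f z - f a) <= M) -> r * Cmod l <= M.
Proof.
  intros Hf Hl Hr HM.
  set (G := fun z => ((f (a + Cexp z) - f a) * Cexp (- z))%C).
  set (v := (0, 2 * PI) : C).
  assert (HG : entire G).
  { intros z. destruct (Hf (a + Cexp z)%C) as [k Hk]. eexists.
    apply (Cderiv_mult (fun w => f (a + Cexp w) - f a)%C (fun w => Cexp (- w)%C)).
    - apply (Cderiv_minus (fun w => f (a + Cexp w)%C) (fun _ => f a)); [|apply Cderiv_const].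
      apply (Cderiv_comp (fun w => f (a + w)%C) Cexp); [|apply Cderiv_Cexp].
      apply Cderiv_shift. exact Hk.
    - apply (Cderiv_comp Cexp Copp); [apply Cderiv_Cexp|apply Cderiv_opp_id]. }
  assert (Hper : forall z, G (z + v)%C = G z).
  { intros z. unfold G. rewrite Cexp_period. f_equal.
    rewrite <- (Cexp_period (- (z + v))%C). f_equal. unfold v. ring. }
  assert (Hv : v <> 0).
  { intros E. apply (f_equal snd) in E. simpl in E. pose proof PI_RGT_0. lra. }
  assert (Hre : forall (p : C) (t : R), fst (p + t * v)%C = fst p)
    by (intros p t; unfold v; simpl; ring).
  assert (Hmul : forall z, (G z * Cexp z = f (a + Cexp z) - f a)%C).
  { intros z. unfold G. rewrite <- Cmult_assoc, <- Cexp_plus.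
    replace (- z + z)%C with (RtoC 0) by ring. rewrite Cexp_0. ring. }
  assert (Hle : Cmod l <= M / r).
  { apply le_epsilon. intros eps He.
    destruct (proj1 (Cderiv_iff f a l) Hl eps He) as [d [Hd Hfa]].
    (* [p] lies over the given circle, [p + u] over the circle of radius
       [d / 2]. *)
    set (p := (ln r, 0) : C).
    set (u := (ln (d / 2) - ln r, 0) : C).
    assert (H1 : Cmod (mean G p v) <= M / r).
    { apply mean_bound; [exact HG|]. intros t _.
      assert (Hm : Cmod (Cexp (p + t * v)) = r)
        by (rewrite Cmod_Cexp, Hre; simpl; now apply exp_ln).
      apply Rle_div_r; [exact Hr|]. rewrite <- Hm, <- Cmod_mult, Hmul. apply HM.
      rewrite <- Hm. f_equal. ring. }
    assert (H2 : Cmod (mean G (p + u) v - l) <= eps).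
    { replace (mean G (p + u) v - l)%C with (mean (fun z => G z - (l + 0 * z))%C (p + u) v).
      2:{ rewrite mean_minus by (exact HG || apply entire_affine).
          rewrite mean_affine. field. }
      apply mean_bound; [apply entire_minus; [exact HG|apply entire_affine]|]. intros t _.
      set (z := (p + u + t * v)%C).
      assert (Hm : Cmod (Cexp z) = d / 2).
      { rewrite Cmod_Cexp. unfold z. rewrite Hre. simpl.
        replace (ln r + (ln (d / 2) - ln r)) with (ln (d / 2)) by ring.
        apply exp_ln. lra. }
      apply Rmult_le_reg_r with (Cmod (Cexp z)); [lra|].
      rewrite <- Cmod_mult.
      replace ((G z - (l + 0 * z)) * Cexp z)%C with (G z * Cexp z - Cexp z * l)%C by ring.
      rewrite Hmul. apply Hfa. lra. }
    rewrite mean_periodic in H2 by assumption.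
    replace l with (mean G p v - (mean G p v - l))%C by ring.
    eapply Rle_trans; [apply Cmod_triangle_minus|]. lra. }
  apply Rle_div_r in Hle; lra.
Qed.

(** [pr] stands for the real or the imaginary part, to which the real mean
    value inequality applies. *)
Lemma is_derive_along (pr : C -> R) (f : C -> C) (w b l : C) (t : R) :
  (forall x y, pr (x - y)%C = pr x - pr y) ->
  (forall (s : R) x, pr (s * x)%C = s * pr x) ->
  (forall x, Rabs (pr x) <= Cmod x) ->
  Cderiv f (w + t * b)%C l ->
  is_derive (fun s : R => pr (f (w + s * b)%C)) t (pr (b * l)%C).
Proof.
  intros Hm Hs Hb Hl. unfold is_derive.
  rewrite filterdiff_locally_iff by apply is_linear_scal_l. intros eps He.
  pose proof (Cmod_ge_0 b) as Hb0.
  destruct (proj1 (Cderiv_iff _ _ _) Hl (eps / (1 + Cmod b))) as [d [Hd H]];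
    [apply Rdiv_lt_0_compat; lra|].
  exists (d / (1 + Cmod b)). split; [apply Rdiv_lt_0_compat; lra|].
  intros s Hst.
  change (Rabs (s - t) < d / (1 + Cmod b)) in Hst.
  change (Rabs (pr (f (w + s * b)%C) - pr (f (w + t * b)%C) - (s - t) * pr (b * l)%C)
    <= eps * Rabs (s - t)).
  rewrite <- Hs, <- !Hm.
  eapply Rle_trans; [apply Hb|].
  set (h := ((s - t)%R * b)%C).
  assert (Hh : Cmod h = Rabs (s - t) * Cmod b) by (unfold h; rewrite Cmod_mult, Cmod_R; ring).
  replace (w + s * b)%C with (w + t * b + h)%C by (unfold h; rewrite RtoC_minus; ring).
  replace ((s - t)%R * (b * l))%C with (h * l)%C by (unfold h; ring).
  apply Rlt_div_r in Hst; [|lra]. pose proof (Rabs_pos (s - t)).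
  assert (Hlt : Cmod h < d) by (rewrite Hh; nra).
  eapply Rle_trans; [apply (H h Hlt)|]. rewrite Hh.
  replace (eps / (1 + Cmod b) * (Rabs (s - t) * Cmod b))
    with (eps * Rabs (s - t) * (Cmod b / (1 + Cmod b))) by (field; lra).
  rewrite <- (Rmult_1_r (eps * Rabs (s - t))) at 2.
  apply Rmult_le_compat_l; [nra|]. apply Rle_div_l; lra.
Qed.

(** The factor [2] comes from treating the real and the imaginary part
    separately. *)
Lemma mean_value_C (f : C -> C) (w b : C) (D : R) :
  (forall t, Rabs t <= 1 -> exists l, Cderiv f (w + t * b)%C l /\ Cmod l <= D) ->
  Cmod (f (w + b) - f w)%C <= 2 * D * Cmod b.
Proof.
  intros H.
  assert (Hpr : forall pr : C -> R,
    (forall x y, pr (x - y)%C = pr x - pr y) ->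
    (forall (s : R) x, pr (s * x)%C = s * pr x) ->
    (forall x, Rabs (pr x) <= Cmod x) ->
    Rabs (pr (f (w + b) - f w)%C) <= D * Cmod b).
  { intros pr Hm Hs Hb. rewrite Hm.
    set (dh := fun t : R => Derive (fun s : R => pr (f (w + s * b)%C)) t).
    pose proof (bounded_variation (fun s : R => pr (f (w + s * b)%C)) dh (D * Cmod b) 0 1) as Hbv.
    simpl in Hbv. rewrite Cmult_1_l, Cmult_0_l, Cplus_0_r, Rminus_0_r, Rabs_R1, Rmult_1_r in Hbv.
    apply Hbv.
    intros t Ht. rewrite Rminus_0_r in Ht.
    destruct (H t Ht) as [l [Hl HD]].
    pose proof (is_derive_along pr f w b l t Hm Hs Hb Hl) as Hd.
    unfold dh. rewrite (is_derive_unique _ _ _ Hd). split; [exact Hd|].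
    eapply Rle_trans; [apply Hb|]. rewrite Cmod_mult, Rmult_comm.
    apply Rmult_le_compat_r; [apply Cmod_ge_0|exact HD]. }
  assert (H1 : Rabs (fst (f (w + b) - f w)%C) <= D * Cmod b).
  { apply (Hpr fst).
    - intros [x1 x2] [y1 y2]; reflexivity.
    - intros s [x1 x2]; simpl; ring.
    - intros x. eapply Rle_trans; [|apply Rmax_Cmod]. apply Rmax_l. }
  assert (H2 : Rabs (snd (f (w + b) - f w)%C) <= D * Cmod b).
  { apply (Hpr snd).
    - intros [x1 x2] [y1 y2]; reflexivity.
    - intros s [x1 x2]; simpl; ring.
    - intros x. eapply Rle_trans; [|apply Rmax_Cmod]. apply Rmax_r. }
  rewrite (surjective_pairing (f (w + b) - f w)%C).
  eapply Rle_trans; [apply Cmod_le_plus|]. lra.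
Qed.

Definition growth (n : nat) (f : C -> C) : Prop :=
  exists M, forall z, Cmod (f z) <= M * (1 + Cmod z) ^ n.

Lemma entire_shift_diff (f : C -> C) (b : C) : entire f -> entire (fun z => f (b + z) - f z)%C.
Proof.
  intros Hf. apply (entire_minus (fun z => f (b + z)%C)); [|exact Hf].
  intros z. destruct (Hf (b + z)%C) as [l Hl]. exists l. now apply Cderiv_shift.
Qed.

(** The Cauchy estimate on the circle of radius [1 + Cmod z], on which [f] has
    the same order of growth as at [z]. *)
Lemma growth_deriv (n : nat) (f : C -> C) (M : R) : entire f ->
  (forall z, Cmod (f z) <= M * (1 + Cmod z) ^ n) ->
  forall z l, Cderiv f z l -> (1 + Cmod z) * Cmod l <= 2 * M * 2 ^ n * (1 + Cmod z) ^ n.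
Proof.
  intros Hf HM z l Hl. pose proof (Cmod_ge_0 z) as Hz.
  apply (cauchy_estimate f z l (1 + Cmod z)); [exact Hf|exact Hl|lra|].
  intros y Hy.
  assert (HM0 : 0 <= M).
  { specialize (HM 0). pose proof (Cmod_ge_0 (f 0)).
    rewrite Cmod_0, Rplus_0_r, pow1 in HM. lra. }
  assert (Hyz : Cmod y <= 1 + 2 * Cmod z).
  { replace y with ((y - z) + z)%C by ring. pose proof (Cmod_triangle (y - z) z). lra. }
  pose proof (Cmod_ge_0 y).
  assert (Hpw : forall x, 0 <= x -> x <= 2 * (1 + Cmod z) -> M * x ^ n <= M * 2 ^ n * (1 + Cmod z) ^ n).
  { intros x Hx0 Hx. rewrite Rmult_assoc, <- Rpow_mult_distr.
    apply Rmult_le_compat_l; [exact HM0|]. apply pow_incr. lra. }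
  eapply Rle_trans; [apply Cmod_triangle_minus|].
  pose proof (HM y). pose proof (HM z).
  pose proof (Hpw (1 + Cmod y) ltac:(lra) ltac:(lra)).
  pose proof (Hpw (1 + Cmod z) ltac:(lra) ltac:(lra)). lra.
Qed.

(** Taking a finite difference lowers the degree of growth, because the
    derivative has growth one degree less; this reduces polynomial growth to
    Liouville's theorem. *)
Lemma growth_diff (n : nat) (f : C -> C) (b : C) : entire f ->
  growth (S n) f -> growth n (fun z => f (b + z) - f z)%C.
Proof.
  intros Hf [M HM].
  assert (HM0 : 0 <= M).
  { specialize (HM 0). pose proof (Cmod_ge_0 (f 0)).
    rewrite Cmod_0, Rplus_0_r, pow1 in HM. lra. }
  set (K := 2 * M * 2 ^ S n).
  assert (HK : 0 <= K) by (unfold K; assert (0 < 2 ^ S n) by (apply pow_lt; lra); nra).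
  exists (2 * K * (1 + Cmod b) ^ n * Cmod b). intros z.
  replace (b + z)%C with (z + b)%C by ring.
  pose proof (Cmod_ge_0 z) as Hz. pose proof (Cmod_ge_0 b) as Hb.
  replace (2 * K * (1 + Cmod b) ^ n * Cmod b * (1 + Cmod z) ^ n)
    with (2 * (K * ((1 + Cmod b) * (1 + Cmod z)) ^ n) * Cmod b)
    by (rewrite Rpow_mult_distr; ring).
  apply mean_value_C. intros t Ht. set (y := (z + t * b)%C).
  destruct (Hf y) as [l Hl]. exists l. split; [exact Hl|].
  pose proof (Cmod_ge_0 y) as Hy0.
  assert (Hy : Cmod y <= Cmod z + Cmod b).
  { unfold y. eapply Rle_trans; [apply Cmod_triangle|]. rewrite Cmod_mult, Cmod_R. nra. }
  pose proof (growth_deriv (S n) f M Hf HM y l Hl) as H. fold K in H.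
  apply Rle_trans with (K * (1 + Cmod y) ^ n).
  - simpl in H. apply Rmult_le_reg_l with (1 + Cmod y); [lra|]. lra.
  - apply Rmult_le_compat_l; [exact HK|]. apply pow_incr. nra.
Qed.

Lemma zero_deriv_const (f : C -> C) :
  (forall z, Cderiv f z 0) -> forall z, f z = f 0.
Proof.
  intros H z. apply Ceq_minus, Cmod_eq_0.
  apply Rle_antisym; [|apply Cmod_ge_0].
  apply Rle_trans with (2 * 0 * Cmod z); [|right; ring].
  replace (f z) with (f (0 + z)%C) by (f_equal; ring).
  apply mean_value_C. intros t _. exists 0. split; [apply H|]. rewrite Cmod_0. lra.
Qed.

Theorem liouville (f : C -> C) : entire f -> growth 0 f -> forall z, f z = f 0.
Proof.
  intros Hf [M HM]. apply zero_deriv_const. intros z. destruct (Hf z) as [l Hl].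
  enough (l = 0) as <- by exact Hl. apply Cmod_eq_0.
  apply Rle_antisym; [|apply Cmod_ge_0]. apply le_epsilon. intros eps He.
  simpl in HM.
  assert (HM0 : 0 <= M) by (specialize (HM 0); pose proof (Cmod_ge_0 (f 0)); lra).
  assert (Hr : 0 < (2 * M + 1) / eps) by (apply Rdiv_lt_0_compat; lra).
  pose proof (cauchy_estimate f z l _ (2 * M) Hf Hl Hr) as H.
  assert (Hb : (2 * M + 1) / eps * Cmod l <= 2 * M).
  { apply H. intros y _. eapply Rle_trans; [apply Cmod_triangle_minus|].
    pose proof (HM y). pose proof (HM z). lra. }
  rewrite Rplus_0_l. apply Rmult_le_reg_l with ((2 * M + 1) / eps); [exact Hr|].
  replace ((2 * M + 1) / eps * eps) with (2 * M + 1) by (field; lra). lra.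
Qed.

(** The derivative of an additive function is the same at every point. *)
Lemma entire_additive_linear (k : C -> C) : entire k ->
  (forall z w, k (z + w) = k z + k w)%C -> exists l, forall z, k z = (l * z)%C.
Proof.
  intros Hk Hadd. destruct (Hk 0) as [l Hl]. exists l.
  assert (Hd : forall z, Cderiv k z l).
  { intros z. apply (Cderiv_ext (fun w => k (- z + w) + k z)%C _ z (l + 0)%C).
    - intros w. rewrite <- Hadd. f_equal. ring.
    - ring.
    - apply (Cderiv_plus (fun w => k (- z + w)%C)); [|apply Cderiv_const].
      apply Cderiv_shift. replace (- z + z)%C with (RtoC 0) by ring. exact Hl. }
  assert (H0 : k 0 = 0).
  { pose proof (Hadd 0 0) as H. rewrite Cplus_0_r in H.
    replace (k 0) with (k 0 + k 0 - k 0)%C by ring. rewrite <- H. ring. }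
  intros z. apply Ceq_minus.
  rewrite (zero_deriv_const (fun w => k w - l * w)%C); [rewrite H0; ring|].
  intros w. apply (Cderiv_ext (fun w => k w - l * w)%C _ w (l - (0 * w + l * 1))%C);
    [reflexivity|ring|].
  apply Cderiv_minus; [apply Hd|].
  apply (Cderiv_mult (fun _ => l)); [apply Cderiv_const|apply Cderiv_id].
Qed.

Lemma growth_1_affine (f : C -> C) : entire f -> growth 1 f ->
  exists l, forall z, f z = (f 0 + l * z)%C.
Proof.
  intros Hf Hg.
  destruct (entire_additive_linear (fun z => f z - f 0)%C) as [l Hl].
  - apply (entire_minus f (fun _ => f 0)); [exact Hf|]. intros z. exists 0. apply Cderiv_const.
  - intros z w.
    pose proof (liouville _ (entire_shift_diff f z Hf) (growth_diff 0 f z Hf Hg) w) as H.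
    simpl in H. rewrite Cplus_0_r in H.
    replace (f (z + w)%C) with (f (z + w) - f w + f w)%C by ring. rewrite H. ring.
  - exists l. intros z. rewrite <- Hl. ring.
Qed.

(** The difference [f (c + z) - f z] is affine in [z]; by the symmetry of [f
    (c + z) - f c - f z] in [c] and [z] its slope is a multiple [a * c] of
    [c]. Subtracting [a / 2 * z ^ 2] leaves an additive function. *)
Lemma growth_2_quadratic (f : C -> C) : entire f -> growth 2 f ->
  exists l q, forall z, f z = (f 0 + l * z + q * z * z)%C.
Proof.
  intros Hf Hg.
  assert (HA : forall c, exists l, forall z, (f (c + z) - f z = f c - f 0 + l * z)%C).
  { intros c. destruct (growth_1_affine _ (entire_shift_diff f c Hf) (growth_diff 1 f c Hf Hg))
      as [l Hl].
    exists l. intros z. rewrite Hl, Cplus_0_r. reflexivity. }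
  destruct (HA 1) as [a Ha].
  assert (Hpol : forall c z, (f (c + z) - f z = f c - f 0 + a * c * z)%C).
  { intros c z. destruct (HA c) as [l Hl].
    enough (l = a * c)%C as <- by apply Hl.
    pose proof (Hl 1) as H1. pose proof (Ha c) as H2.
    rewrite (Cplus_comm 1 c) in H2.
    replace l with ((f (c + 1) - f 1) - (f c - f 0))%C by (rewrite H1; ring).
    replace (f (c + 1)%C) with ((f (c + 1) - f c) + f c)%C by ring. rewrite H2. ring. }
  set (k := fun z => (f z - f 0 - a / 2 * z * z)%C).
  destruct (entire_additive_linear k) as [l Hl].
  - apply (entire_minus (fun z => f z - f 0)%C (fun z => a / 2 * z * z)%C).
    + apply (entire_minus f (fun _ => f 0)); [exact Hf|]. intros z. exists 0. apply Cderiv_const.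
    + intros z. eexists. apply (Cderiv_mult (fun z => a / 2 * z)%C); [|apply Cderiv_id].
      apply (Cderiv_mult (fun _ => a / 2)%C); [apply Cderiv_const|apply Cderiv_id].
  - intros z w. unfold k. replace (f (z + w)%C) with (f (z + w) - f w + f w)%C by ring.
    rewrite Hpol. field.
  - exists l, (a / 2)%C. intros z. rewrite <- Hl. unfold k. ring.
Qed.

(** * Injective entire functions *)

(** The factor [w * w] in place of [w] gives a function whose
    differentiability at [0] needs nothing beyond the first-order expansion of
    [f]. *)
Lemma Cderiv_square_quotient (f : C -> C) (l : C) :
  Cderiv f 0 l -> l <> 0 -> Cderiv (fun w => w * w / (f w - f 0))%C 0 (/ l)%C.
Proof.
  intros Hl Hnz. apply Cderiv_iff. intros eps He.
  pose proof (proj1 (Cmod_gt_0 l) Hnz) as Hm. set (m := Cmod l) in *.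
  set (eta := Rmin (m / 2) (eps * (m * m / 2))).
  assert (Heta : 0 < eta).
  { apply Rmin_pos; [lra|]. apply Rmult_lt_0_compat; [lra|]. assert (0 < m * m) by nra. lra. }
  assert (Heta1 : eta <= m / 2) by apply Rmin_l.
  assert (Heta2 : eta <= eps * (m * m / 2)) by apply Rmin_r.
  destruct (proj1 (Cderiv_iff _ _ _) Hl eta Heta) as [d [Hd H]].
  exists d. split; [exact Hd|]. intros h Hh. specialize (H h Hh).
  rewrite Cplus_0_l in *. set (D := (f h - f 0)%C) in *.
  destruct (Ceq_dec h 0) as [->|Hh0].
  { unfold D. replace (0 * 0 / (f 0 - f 0) - 0 * 0 / (f 0 - f 0) - 0 * / l)%C with (RtoC 0) by ring.
    rewrite Cmod_0. lra. }
  pose proof (proj1 (Cmod_gt_0 h) Hh0) as Hhp.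
  assert (HD : m / 2 * Cmod h <= Cmod D).
  { pose proof (Cmod_triangle_inv (h * l) (D - h * l)) as Ht.
    rewrite Cmod_mult in Ht. fold m in Ht.
    replace (h * l + (D - h * l))%C with D in Ht by ring. nra. }
  assert (HD0 : D <> 0).
  { intros E. rewrite E, Cmod_0 in HD.
    assert (0 < m / 2 * Cmod h) by (apply Rmult_lt_0_compat; lra). lra. }
  replace (h * h / D - 0 * 0 / (f 0 - f 0) - h * / l)%C
    with (- (h * (D - h * l) / (D * l)))%C.
  2:{ unfold Cdiv at 3. rewrite !Cmult_0_l. field. split; assumption. }
  rewrite Cmod_opp, Cmod_div, !Cmod_mult by now apply Cmult_neq_0. fold m.
  assert (0 < m / 2 * Cmod h) by (apply Rmult_lt_0_compat; lra).
  apply Rle_div_l; [apply Rmult_lt_0_compat; lra|].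
  apply Rle_trans with (Cmod h * (eta * Cmod h)); [apply Rmult_le_compat_l; lra|].
  apply Rle_trans with (eps * Cmod h * (m / 2 * Cmod h * m)).
  - replace (eps * Cmod h * (m / 2 * Cmod h * m)) with (Cmod h * (eps * (m * m / 2) * Cmod h)) by field.
    apply Rmult_le_compat_l; [lra|]. apply Rmult_le_compat_r; lra.
  - apply Rmult_le_compat_l; [nra|]. apply Rmult_le_compat_r; lra.
Qed.

(** Continuity of [g] at [f 0] bounds [f z - f 0] away from [0] outside any
    neighbourhood of [0], so that [h z = z ^ 2 / (f z - f 0)] is an entire
    function of quadratic growth. Hence [h z = a * z + b * z ^ 2], that is, [z
    = (f z - f 0) * (a + b * z)] for [z <> 0]. As the left-hand side has no
    zero there, neither has [a + b * z]; since [a <> 0] by injectivity, this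
    forces [b = 0]. *)
Theorem entire_left_inverse_affine (f g : C -> C) : entire f -> entire g ->
  (forall z, g (f z) = z) -> exists l, forall z, f z = (f 0 + l * z)%C.
Proof.
  intros Hf Hg Hgf.
  assert (Hinj : forall z : C, z <> 0 -> (f z - f 0)%C <> 0).
  { intros z Hz E. apply Ceq_minus in E. apply (f_equal g) in E.
    rewrite !Hgf in E. now apply Hz. }
  destruct (Hf 0) as [l Hl]. destruct (Hg (f 0)) as [m Hm].
  assert (Hl0 : l <> 0).
  { intros ->. pose proof (Cderiv_comp g f 0 m 0 Hm Hl) as Hc.
    pose proof (Cderiv_ext _ (fun w => w) 0 _ _ Hgf eq_refl Hc) as Hc'.
    destruct (proj1 (Cderiv_iff _ _ _) Hc' (1 / 2) ltac:(lra)) as [d [Hd H]].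
    (* The chain rule for [g (f z) = z] would give [1 = 0]. *)
    specialize (H (RtoC (d / 2))).
    replace (0 + (d / 2)%R - 0 - (d / 2)%R * (0 * m))%C with (RtoC (d / 2)) in H by ring.
    rewrite Cmod_R, Rabs_right in H by lra. specialize (H ltac:(lra)). lra. }
  set (h := fun w => (w * w / (f w - f 0))%C).
  assert (Hh0 : Cderiv h 0 (/ l)%C) by now apply Cderiv_square_quotient.
  assert (Hhe : entire h).
  { intros z. destruct (Ceq_dec z 0) as [->|Hz]; [eexists; exact Hh0|].
    destruct (Hf z) as [k Hk]. eexists.
    apply (Cderiv_mult (fun w => w * w)%C (fun w => / (f w - f 0))%C).
    - apply Cderiv_mult; apply Cderiv_id.
    - apply (Cderiv_comp Cinv (fun w => f w - f 0)%C).
      + apply Cderiv_inv. now apply Hinj.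
      + apply (Cderiv_minus f); [exact Hk|apply Cderiv_const]. }
  (* The quotient at [0] is multiplied by [0], whatever its value. *)
  assert (Hh00 : h 0 = 0) by (unfold h, Cdiv; rewrite !Cmult_0_l; reflexivity).
  assert (Hgr : growth 2 h).
  { destruct (Cderiv_continuous h 0 _ Hh0 1 Rlt_0_1) as [d1 [Hd1 Hc1]].
    destruct (Cderiv_continuous g (f 0) m Hm d1 Hd1) as [d2 [Hd2 Hc2]].
    exists (1 + / d2). intros z.
    assert (Hi : 0 < / d2) by now apply Rinv_0_lt_compat.
    pose proof (Cmod_ge_0 z) as Hz0.
    destruct (Rlt_le_dec (Cmod z) d1) as [Hz|Hz].
    - specialize (Hc1 z Hz). rewrite Cplus_0_l, Hh00 in Hc1.
      replace (h z - 0)%C with (h z) in Hc1 by ring. nra.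
    - assert (Hz1 : z <> 0) by (intros ->; rewrite Cmod_0 in Hz; lra).
      assert (Hd : d2 <= Cmod (f z - f 0)).
      { apply Rnot_lt_le. intros Hlt. specialize (Hc2 _ Hlt).
        replace (f 0 + (f z - f 0))%C with (f z) in Hc2 by ring.
        rewrite !Hgf in Hc2. replace (z - 0)%C with z in Hc2 by ring. lra. }
      unfold h. rewrite Cmod_div, Cmod_mult by now apply Hinj.
      apply Rle_div_l; [lra|].
      assert (1 <= (1 + / d2) * Cmod (f z - f 0)).
      { apply Rle_trans with ((1 + / d2) * d2).
        - rewrite Rmult_plus_distr_r, Rinv_l by lra. lra.
        - apply Rmult_le_compat_l; lra. }
      replace ((1 + / d2) * (1 + Cmod z) ^ 2 * Cmod (f z - f 0))
        with ((1 + Cmod z) ^ 2 * ((1 + / d2) * Cmod (f z - f 0))) by ring.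
      apply Rle_trans with ((1 + Cmod z) ^ 2 * 1); [nra|].
      apply Rmult_le_compat_l; [apply pow_le; lra|assumption]. }
  destruct (growth_2_quadratic h Hhe Hgr) as [a [b Hab]].
  assert (Heq : forall z : C, z <> 0 -> (z = (f z - f 0) * (a + b * z))%C).
  { intros z Hz. pose proof (Hab z) as H. rewrite Hh00 in H.
    assert (E : (z * z = (f z - f 0) * h z)%C) by (unfold h; field; now apply Hinj).
    rewrite H in E.
    assert (E' : (z * (z - (f z - f 0) * (a + b * z)))%C = 0).
    { replace (z * (z - (f z - f 0) * (a + b * z)))%C
        with (z * z - (f z - f 0) * (0 + a * z + b * z * z))%C by ring.
      rewrite E. ring. }
    apply Ceq_minus.
    destruct (Ceq_dec (z - (f z - f 0) * (a + b * z))%C 0) as [e|e]; [exact e|].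
    now destruct (Cmult_neq_0 _ _ Hz e). }
  assert (Ha : a <> 0).
  { (* If [a = 0], then [f - f 0] is constant off [0], against injectivity. *)
    intros ->.
    assert (Hc : forall z : C, z <> 0 -> ((f z - f 0) * b)%C = 1).
    { intros z Hz. pose proof (Heq z Hz) as E.
      replace ((f z - f 0) * b)%C with ((f z - f 0) * (0 + b * z) / z)%C by (field; exact Hz).
      rewrite <- E. field. exact Hz. }
    assert (H2 : RtoC 2 <> 0) by (intros E; apply RtoC_inj in E; lra).
    assert (Hb : b <> 0).
    { intros ->. pose proof (Hc 1 C1_nz) as E. rewrite Cmult_0_r in E. now apply C1_nz. }
    assert (E12 : f 1 = f 2).
    { apply Ceq_minus. destruct (Ceq_dec (f 1 - f 2)%C 0) as [e|e]; [exact e|].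
      exfalso. apply (Cmult_neq_0 _ _ e Hb).
      replace ((f 1 - f 2) * b)%C with ((f 1 - f 0) * b - (f 2 - f 0) * b)%C by ring.
      rewrite (Hc 1 C1_nz), (Hc 2 H2). ring. }
    apply (f_equal g) in E12. rewrite !Hgf in E12. apply RtoC_inj in E12. lra. }
  assert (Hb : b = 0).
  { destruct (Ceq_dec b 0) as [e|Hb]; [exact e|exfalso].
    assert (Hz : (- (a / b))%C <> 0).
    { intros E. apply Ha. replace a with (- (- (a / b)) * b)%C by (field; exact Hb).
      rewrite E. ring. }
    pose proof (Heq _ Hz) as E. apply Hz. rewrite E. field. exact Hb. }
  subst b. exists (/ a)%C. intros z. destruct (Ceq_dec z 0) as [->|Hz]; [ring|].
  pose proof (Heq z Hz) as E. rewrite E at 2. field. exact Ha.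
Qed.

(** * Finite sets and compactness *)

Lemma finite_set_iff_list {T : Type} (A : T -> Prop) :
  finite_set A <-> exists l : list T, forall x, A x -> In x l.
Proof.
  split.
  - intros H. induction H as [|A _ [l Hl] x _].
    + exists nil. intros x [].
    + exists (x :: l). intros y Hy. destruct Hy as [y Hy|y Hy].
      * right. now apply Hl.
      * left. now destruct Hy.
  - intros [l Hl]. revert A Hl. induction l as [|a l IH]; intros A Hl.
    + replace A with (Ensembles.Empty_set T); [constructor|].
      apply functional_extensionality. intros x. apply propositional_extensionality.
      split; [intros []|intros Hx; destruct (Hl x Hx)].
    + set (B := fun x => A x /\ x <> a).
      assert (HB : finite_set B).
      { apply IH. intros x [Hx Hxa]. destruct (Hl x Hx) as [E|E]; [|exact E].
        now destruct Hxa. }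
      destruct (classic (A a)) as [Ha|Ha].
      * replace A with (Ensembles.Add T B a).
        { constructor; [exact HB|]. intros [_ H]. now apply H. }
        apply functional_extensionality. intros x. apply propositional_extensionality. split.
        -- intros [y [Hy _]|y Hy]; [exact Hy|now destruct Hy].
        -- intros Hx. destruct (classic (x = a)) as [->|Hxa].
           ++ right. constructor.
           ++ left. now split.
      * replace A with B; [exact HB|].
        apply functional_extensionality. intros x. apply propositional_extensionality. split.
        -- now intros [Hx _].
        -- intros Hx. split; [exact Hx|]. intros ->. now apply Ha.
Qed.

(** Cover the compact set by open sets that contain at most one point of [D]
    each. *)
Lemma discrete_compact_finite {V : UniformSpace} (X D K : V -> Prop) :
  discrete_in X D -> compact_set K -> (forall x, K x -> X x) ->
  finite_set (fun x => D x /\ K x).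
Proof.
  intros [_ HD] HK HKX. apply finite_set_iff_list.
  set (I := {U : V -> Prop | open U /\ exists x, forall y, U y -> D y -> y = x}).
  destruct (HK I (fun i => proj1_sig i)) as [l Hl].
  - intros [U [HU HU']]. exact HU.
  - intros x Hx. specialize (HD x (HKX x Hx)).
    apply not_all_ex_not in HD. destruct HD as [N HN].
    apply imply_to_and in HN. destruct HN as [HN HN'].
    assert (HU : open (fun y => locally y N)) by (intros y Hy; now apply locally_locally).
    assert (HU' : exists x0, forall y, locally y N -> D y -> y = x0).
    { exists x. intros y Hy HDy. apply NNPP. intros Hne. apply HN'. exists y.
      split; [now apply locally_singleton|]. now split. }
    exists (exist _ (fun y => locally y N) (conj HU HU')). exact HN.
  - assert (H : forall l : list I, exists m : list V,
      forall x, D x -> (exists i, In i l /\ proj1_sig i x) -> In x m).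
    { clear. induction l as [|[U [HU [x0 Hx0]]] l [m Hm]].
      - exists nil. now intros x _ [i [[] _]].
      - exists (x0 :: m). intros x Hx [i [[<-|Hi] HUx]].
        + left. symmetry. now apply Hx0.
        + right. apply Hm; [exact Hx|]. now exists i. }
    destruct (H l) as [m Hm]. exists m. intros x [HDx HKx]. apply Hm; auto.
Qed.

(** A compactness principle for gauges, applied to the radii of balls
    contained in members of the cover. *)
Lemma compact_interval (a b : R) : compact_set (fun x : R => a <= x <= b).
Proof.
  intros I U HU Hcov.
  assert (Hd : forall x : R, exists d : posreal, a <= x <= b ->
    exists i, forall y, Rabs (y - x) < d -> U i y).
  { intros x. destruct (classic (a <= x <= b)) as [Hx|Hx].
    - destruct (Hcov x Hx) as [i Hi]. destruct (HU i x Hi) as [d Hd].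
      exists d. intros _. exists i. intros y Hy. apply Hd. exact Hy.
    - exists (mkposreal 1 Rlt_0_1). now intros H. }
  apply NNPP. intros Hno.
  apply (compactness_list 1 (a, tt) (b, tt)
    (fun t => proj1_sig (constructive_indefinite_description _ (Hd (fst t))))).
  intros [l Hl]. apply Hno. clear Hno.
  set (P := fun (t : R * unit) (i : I) => forall y,
    Rabs (y - fst t) < proj1_sig (constructive_indefinite_description _ (Hd (fst t))) -> U i y).
  assert (H : forall l : list (R * unit), exists m : list I, forall t, In t l ->
    (exists i, P t i) -> exists i, In i m /\ P t i).
  { clear. induction l as [|t l [m Hm]].
    - exists nil. now intros t [].
    - destruct (classic (exists i, P t i)) as [[i Hi]|Hn].
      + exists (i :: m). intros s [<-|Hs] Hex.
        * exists i. now split; [left|].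
        * destruct (Hm s Hs Hex) as [j [Hj Hj']]. exists j. now split; [right|].
      + exists m. intros s [<-|Hs] Hex; [now destruct Hn|now apply Hm]. }
  destruct (H l) as [m Hm]. exists m. intros x Hx.
  destruct (Hl (x, tt)) as [[t []] [Ht [[Hb _] [Hc _]]]]; [now split|].
  destruct (Hm _ Ht) as [i [Hi HPi]].
  - simpl in Hb.
    exact (proj2_sig (constructive_indefinite_description _ (Hd t)) Hb).
  - exists i. split; [exact Hi|]. apply HPi. exact Hc.
Qed.

(** The tube lemma: over a neighbourhood of each point of [A], finitely many
    members of the cover already cover the whole of [B]. *)
Lemma compact_product {V W : UniformSpace} (A : V -> Prop) (B : W -> Prop) :
  compact_set A -> compact_set B ->
  compact_set (V := prod_UniformSpace V W) (fun p => A (fst p) /\ B (snd p)).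
Proof.
  intros HA HB I U HU Hcov.
  set (J := {lN : list I * (V -> Prop) | open (snd lN) /\
     forall x y, snd lN x -> B y -> exists i, In i (fst lN) /\ U i (x, y)}).
  destruct (HA J (fun j => snd (proj1_sig j))) as [m Hm].
  - intros j. exact (proj1 (proj2_sig j)).
  - intros a Ha.
    set (J' := {iNM : I * (V -> Prop) * (W -> Prop) |
      open (snd (fst iNM)) /\ snd (fst iNM) a /\ open (snd iNM) /\
      forall x y, snd (fst iNM) x -> snd iNM y -> U (fst (fst iNM)) (x, y)}).
    destruct (HB J' (fun j => snd (proj1_sig j))) as [m Hm].
    + intros j. exact (proj1 (proj2 (proj2 (proj2_sig j)))).
    + intros b Hb. destruct (Hcov (a, b) (conj Ha Hb)) as [i Hi].
      destruct (HU i (a, b) Hi) as [d Hd].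
      assert (H : open (fun x => locally x (ball a d)) /\ locally a (ball a d) /\
        open (fun y => locally y (ball b d)) /\
        forall x y, locally x (ball a d) -> locally y (ball b d) -> U i (x, y)).
      { split; [intros x Hx; now apply locally_locally|].
        split; [apply locally_ball|].
        split; [intros x Hx; now apply locally_locally|].
        intros x y Hx Hy. apply Hd. split; now apply locally_singleton. }
      exists (exist _ (i, (fun x => locally x (ball a d)), (fun y => locally y (ball b d))) H).
      apply locally_ball.
    + assert (H : forall m : list J', exists N : V -> Prop, open N /\ N a /\
        forall x j, N x -> In j m -> snd (fst (proj1_sig j)) x).
      { clear. induction m as [|[[[i N0] M0] H0] m [N [HN1 [HN2 HN3]]]].
        - exists (fun _ => True). split; [apply open_true|]. now split.
        - exists (fun x => N0 x /\ N x). simpl in H0.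
          split; [now apply open_and|]. split; [now split|].
          intros x j [Hx1 Hx2] [<-|Hj]; [exact Hx1|now apply HN3]. }
      destruct (H m) as [N [HN1 [HN2 HN3]]].
      assert (Hl : forall x y, N x -> B y ->
        exists i, In i (map (fun j : J' => fst (fst (proj1_sig j))) m) /\ U i (x, y)).
      { intros x y Hx Hy. destruct (Hm y Hy) as [j [Hj Hjy]].
        exists (fst (fst (proj1_sig j))). split; [now apply (in_map (fun j : J' => fst (fst (proj1_sig j))))|].
        pose proof (HN3 x j Hx Hj) as Hjx.
        now apply (proj2 (proj2 (proj2 (proj2_sig j)))). }
      now exists (exist _ (_, N) (conj HN1 Hl)).
  - exists (flat_map (fun j : J => fst (proj1_sig j)) m). intros [x y] [Hx Hy].
    destruct (Hm x Hx) as [j [Hj Hjx]].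
    destruct (proj2 (proj2_sig j) x y Hjx Hy) as [i [Hi HUi]].
    exists i. split; [|exact HUi]. apply in_flat_map. now exists j.
Qed.

(** The complement of the closed set is added to the cover. *)
Lemma compact_closed_subset {V : UniformSpace} (A B : V -> Prop) :
  compact_set A -> closed B -> (forall x, B x -> A x) -> compact_set B.
Proof.
  intros HA HB HBA I U HU Hcov.
  destruct (HA (option I) (fun o => match o with Some i => U i | None => fun x => ~ B x end))
    as [l Hl].
  - intros [i|]; [apply HU|now apply open_not].
  - intros x _. destruct (classic (B x)) as [Hx|Hx].
    + destruct (Hcov x Hx) as [i Hi]. now exists (Some i).
    + now exists None.
  - exists (flat_map (fun o => match o with Some i => i :: nil | None => nil end) l).
    intros x Hx. destruct (Hl x (HBA x Hx)) as [[i|] [Hi Hix]].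
    + exists i. split; [|exact Hix]. apply in_flat_map. exists (Some i). now split; [|left].
    + now destruct Hix.
Qed.

(** * An exhaustion of the product of the disc with the plane *)

Lemma continuous_Cmod {U : UniformSpace} (f : U -> C) (x : U) :
  continuous (U := C_UniformSpace) f x -> continuous (U := R_UniformSpace) (fun y => Cmod (f y)) x.
Proof.
  intros Hf. apply (continuous_comp (V := C_UniformSpace) (W := R_UniformSpace) f Cmod); [exact Hf|].
  exact (filterlim_norm (V := C_NormedModule) (f x)).
Qed.

Lemma compact_disc (r : R) : compact_set (V := C_UniformSpace) (fun z => Cmod z <= r).
Proof.
  apply (compact_closed_subset (V := C_UniformSpace)
    (fun z => (- r <= fst z <= r) /\ (- r <= snd z <= r))).
  - exact (compact_product _ _ (compact_interval (- r) r) (compact_interval (- r) r)).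
  - apply (closed_comp (T := C_UniformSpace) (U := R_UniformSpace) Cmod (fun u => u <= r)); [|apply closed_le].
    intros z. apply (continuous_Cmod (U := C_UniformSpace) (fun z => z)), continuous_id.
  - intros z Hz. pose proof (Rmax_Cmod z) as H.
    pose proof (Rmax_l (Rabs (fst z)) (Rabs (snd z))).
    pose proof (Rmax_r (Rabs (fst z)) (Rabs (snd z))).
    split; apply Rabs_le_between; lra.
Qed.

Lemma continuous_Cmod_fst (x : C2) : continuous (T := C2) (U := R_UniformSpace) (fun y : C2 => Cmod (fst y)) x.
Proof. apply (continuous_Cmod (U := C2) fst), continuous_fst. Qed.

Lemma continuous_Cmod_snd (x : C2) : continuous (T := C2) (U := R_UniformSpace) (fun y : C2 => Cmod (snd y)) x.
Proof. apply (continuous_Cmod (U := C2) snd), continuous_snd. Qed.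

(** Of order [Cmod (snd x)] on vertical lines, locally uniformly in [fst x]:
    this is what linear growth of automorphisms is compared with. *)
Definition sum_exhaustion (x : C2) : R := Cmod (snd x) + / (1 - Cmod (fst x)).

(** The sublevel set is written with the product [(c - |w|) * (1 - |z|)],
    which is continuous on the whole space, so that it is a closed subset of a
    compact bidisc. *)
Lemma exhaustion_sum : exhaustion disc_times_C sum_exhaustion.
Proof.
  unfold exhaustion, disc_times_C, unit_disc, sum_exhaustion. repeat split.
  - intros x Hx. pose proof (Cmod_ge_0 (snd x)).
    assert (0 < / (1 - Cmod (fst x))) by (apply Rinv_0_lt_compat; lra). lra.
  - intros x Hx. apply (continuous_plus (K := R_AbsRing) (V := R_NormedModule)).
    + apply continuous_Cmod_snd.
    + apply (continuous_comp (U := C2) (V := R_UniformSpace) (W := R_UniformSpace)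
        (fun y : C2 => 1 - Cmod (fst y)) Rinv).
      * apply (continuous_minus (K := R_AbsRing) (V := R_NormedModule));
          [apply continuous_const|apply continuous_Cmod_fst].
      * apply continuous_Rinv. lra.
  - intros c.
    apply (compact_closed_subset (V := C2) (fun x : C2 => Cmod (fst x) <= 1 /\ Cmod (snd x) <= c)).
    + exact (compact_product _ _ (compact_disc 1) (compact_disc c)).
    + apply (closed_ext (T := C2) (fun x : C2 => (Cmod (fst x) <= 1 /\ Cmod (snd x) <= c) /\
        1 <= (c - Cmod (snd x)) * (1 - Cmod (fst x)))).
      * intros x. split.
        -- intros [[H1 H2] H3].
           assert (H4 : Cmod (fst x) < 1).
           { apply Rnot_le_lt. intros H4. replace (Cmod (fst x)) with 1 in H3 by lra. lra. }
           split; [exact H4|].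
           assert (/ (1 - Cmod (fst x)) <= c - Cmod (snd x)); [|lra].
           apply Rmult_le_reg_r with (1 - Cmod (fst x)); [lra|]. rewrite Rinv_l; lra.
        -- intros [H1 H2].
           assert (0 < / (1 - Cmod (fst x))) by (apply Rinv_0_lt_compat; lra).
           split; [split; lra|].
           apply Rle_trans with (/ (1 - Cmod (fst x)) * (1 - Cmod (fst x))).
           { rewrite Rinv_l; lra. }
           apply Rmult_le_compat_r; lra.
      * apply closed_and; [apply closed_and|].
        -- apply (closed_comp (T := C2) (U := R_UniformSpace) (fun y : C2 => Cmod (fst y)) (fun u => u <= 1));
             [exact continuous_Cmod_fst|apply closed_le].
        -- apply (closed_comp (T := C2) (U := R_UniformSpace) (fun y : C2 => Cmod (snd y)) (fun u => u <= c));
             [exact continuous_Cmod_snd|apply closed_le].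
        -- apply (closed_comp (T := C2) (U := R_UniformSpace)
             (fun y : C2 => (c - Cmod (snd y)) * (1 - Cmod (fst y))) (fun u => 1 <= u)); [|apply closed_ge].
           intros x. apply (continuous_mult (U := C2) (K := R_AbsRing)
             (fun y : C2 => c - Cmod (snd y)) (fun y : C2 => 1 - Cmod (fst y)));
             apply (continuous_minus (K := R_AbsRing) (V := R_NormedModule));
             (exact (continuous_const _ x) || exact (continuous_Cmod_fst x) || exact (continuous_Cmod_snd x)).
    + intros x [H1 H2]. assert (0 < / (1 - Cmod (fst x))) by (apply Rinv_0_lt_compat; lra). lra.
Qed.

(** * Automorphisms restricted to vertical lines *)

Lemma norm_C2_vertical (h : C) : norm ((0 : C, h) : C2) = Cmod h.
Proof.
  change (sqrt (Cmod 0 ^ 2 + Cmod h ^ 2) = Cmod h).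
  rewrite Cmod_0. replace (0 ^ 2 + Cmod h ^ 2) with (Cmod h ^ 2) by ring.
  apply sqrt_pow2, Cmod_ge_0.
Qed.

Lemma Cmod_coordinates_le_norm (x : C2) : Cmod (fst x) <= norm x /\ Cmod (snd x) <= norm x.
Proof.
  destruct x as [a b]. pose proof (proj1 (norm_prod (K := C_AbsRing) (U := C_NormedModule) (V := C_NormedModule) a b)) as H.
  change (Rmax (Cmod a) (Cmod b) <= norm ((a, b) : C2)) in H.
  pose proof (Rmax_l (Cmod a) (Cmod b)). pose proof (Rmax_r (Cmod a) (Cmod b)). simpl fst; simpl snd.
  split; lra.
Qed.

Lemma holomorphic_fibre (phi : C2 -> C2) (z w : C) :
  ex_filterdiff phi (locally (z, w)) ->
  (exists l, Cderiv (fun u => fst (phi (z, u))) w l) /\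
  (exists l, Cderiv (fun u => snd (phi (z, u))) w l).
Proof.
  intros [L HL]. pose proof HL as [Hlin _]. rewrite (filterdiff_locally_iff _ _ _ Hlin) in HL.
  set (v := L ((0 : C, 1 : C) : C2)).
  assert (H : forall eps : R, 0 < eps -> exists delta : R, 0 < delta /\
    forall h, Cmod h < delta ->
      Cmod (fst (phi (z, w + h)%C) - fst (phi (z, w)) - h * fst v) <= eps * Cmod h /\
      Cmod (snd (phi (z, w + h)%C) - snd (phi (z, w)) - h * snd v) <= eps * Cmod h).
  { intros eps He. destruct (HL eps He) as [d [Hd Hy]]. exists d. split; [exact Hd|].
    intros h Hh. specialize (Hy ((z, (w + h)%C) : C2)).
    assert (E : minus ((z, (w + h)%C) : C2) (z, w) = ((0 : C, h) : C2)).
    { apply injective_projections; simpl.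
      - change (z - z = 0)%C. ring.
      - change (w + h - w = h)%C. ring. }
    rewrite E, norm_C2_vertical in Hy. specialize (Hy Hh).
    assert (El : L ((0 : C, h) : C2) = scal h v).
    { unfold v. rewrite <- (linear_scal L Hlin). f_equal.
      apply injective_projections; simpl.
      - change (RtoC 0 = h * 0)%C. ring.
      - change (h = h * 1)%C. ring. }
    rewrite El in Hy.
    match type of Hy with norm ?x <= _ => destruct (Cmod_coordinates_le_norm x) as [H1 H2] end.
    split; (eapply Rle_trans; [|exact Hy]); assumption. }
  split; [exists (fst v)|exists (snd v)]; apply Cderiv_iff; intros eps He;
    destruct (H eps He) as [d [Hd Hh]]; exists d; (split; [exact Hd|]);
    intros h Hhd; apply (Hh h Hhd).
Qed.

(** The first coordinate is a bounded entire function of [w], hence constant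
    by Liouville's theorem. The second coordinate of the inverse, on the image
    line, is therefore an entire left inverse of the second coordinate. *)
Lemma automorphism_fibre (phi : C2 -> C2) : automorphism disc_times_C phi ->
  forall z, unit_disc z -> forall w : C,
    fst (phi (z, w)) = fst (phi (z, RtoC 0)) /\
    snd (phi (z, w)) =
      (snd (phi (z, RtoC 0)) + (snd (phi (z, RtoC 1)) - snd (phi (z, RtoC 0))) * w)%C :> C.
Proof.
  intros [HX [Hhol [psi [HX' [Hhol' [Hinv _]]]]]] z Hz.
  assert (Hfst : forall w, fst (phi (z, w)) = fst (phi (z, RtoC 0))).
  { apply (liouville (fun w => fst (phi (z, w)))).
    - intros w. exact (proj1 (holomorphic_fibre phi z w (Hhol (z, w) Hz))).
    - exists 1. intros w. simpl. rewrite Rmult_1_r. apply Rlt_le. now apply (HX (z, w)). }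
  intros w. split; [apply Hfst|]. revert w.
  set (a := fst (phi (z, RtoC 0))) in *.
  assert (Ha : unit_disc a) by (apply (HX (z, RtoC 0)); exact Hz).
  destruct (entire_left_inverse_affine (fun w => snd (phi (z, w))) (fun u => snd (psi (a, u))))
    as [l Hl].
  - intros w. exact (proj2 (holomorphic_fibre phi z w (Hhol (z, w) Hz))).
  - intros u. exact (proj2 (holomorphic_fibre psi a u (Hhol' (a, u) Ha))).
  - intros w. rewrite <- (Hfst w), <- surjective_pairing, Hinv by exact Hz. reflexivity.
  - intros w. cbv beta in Hl. rewrite (Hl w), (Hl (RtoC 1)). ring.
Qed.

(** * Necessity *)

Lemma continuous_lt_locally {U : UniformSpace} (f : U -> R) (x : U) (M : R) :
  continuous (U := R_UniformSpace) f x -> f x < M -> locally x (fun y => f y < M).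
Proof. intros Hf HM. exact (Hf _ (open_lt M (f x) HM)). Qed.

(** A point of a space with separated points is isolated in any finite set. *)
Lemma locally_avoid_list {V : UniformSpace} (p : V) (l : list V) :
  (forall a, a <> p -> locally p (fun y => y <> a)) ->
  locally p (fun y => In y l -> y = p).
Proof.
  intros Hsep. induction l as [|a l IH].
  - apply filter_forall. intros y [].
  - destruct (classic (a = p)) as [->|Ha].
    + apply filter_imp with (2 := IH). intros y Hy [<-|H]; auto.
    + apply filter_imp with (2 := filter_and _ _ IH (Hsep a Ha)).
      intros y [Hy1 Hy2] [<-|H]; [now destruct Hy2|auto].
Qed.

(** For the bound [|w| ^ 2], tameness gives [|w| ^ 2 <= A + B * |w|] at the
    points of [D] above a neighbourhood of [p], since automorphisms are affine
    on vertical lines, with coefficients that are continuous in [z]. *)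
Lemma tame_vertically_bounded (D : C2 -> Prop) : tame disc_times_C D ->
  forall p, unit_disc p -> exists W, locally (T := C_UniformSpace) p
    (fun z : C => unit_disc z /\ forall w : C, D (z, w) -> Cmod w <= W).
Proof.
  intros [_ [[HDX _] Htame]] p Hp.
  destruct (Htame sum_exhaustion exhaustion_sum (fun x => Cmod (snd x) ^ 2)) as [phi [Haut Hphi]].
  { intros x _. apply pow2_ge_0. }
  pose proof (automorphism_fibre phi Haut) as Hfib.
  destruct Haut as [HX [Hhol _]].
  assert (Hcont : forall c : C, continuous (T := C_UniformSpace) (U := C2) (fun z => phi (z, c)) p).
  { intros c. apply (continuous_comp (U := C_UniformSpace) (V := C2) (W := C2) (fun z => (z, c) : C2) phi).
    - intros P [d Hd]. exists d. intros y Hy. apply Hd. split; [exact Hy|apply ball_center].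
    - apply (filterdiff_continuous (K := C_AbsRing)). now apply Hhol. }
  assert (Hc1 : forall c : C, continuous (T := C_UniformSpace) (U := R_UniformSpace)
    (fun z : C => Cmod (fst (phi (z, c)))) p).
  { intros c. apply (continuous_comp (U := C_UniformSpace) (V := C2) (W := R_UniformSpace)
      (fun z => phi (z, c)) (fun y : C2 => Cmod (fst y))); [apply Hcont|apply continuous_Cmod_fst]. }
  assert (Hc2 : forall c : C, continuous (T := C_UniformSpace) (U := R_UniformSpace)
    (fun z : C => Cmod (snd (phi (z, c)))) p).
  { intros c. apply (continuous_comp (U := C_UniformSpace) (V := C2) (W := R_UniformSpace)
      (fun z => phi (z, c)) (fun y : C2 => Cmod (snd y))); [apply Hcont|apply continuous_Cmod_snd]. }
  set (q := (1 + Cmod (fst (phi (p, RtoC 0)))) / 2).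
  set (B := Cmod (snd (phi (p, RtoC 0))) + Cmod (snd (phi (p, RtoC 1))) + 1).
  pose proof (HX (p, RtoC 0) Hp) as Hq. unfold disc_times_C, unit_disc in Hq.
  assert (Hq1 : q < 1) by (unfold q; lra).
  pose proof (Cmod_ge_0 (snd (phi (p, RtoC 0)))) as HB0.
  pose proof (Cmod_ge_0 (snd (phi (p, RtoC 1)))) as HB1.
  exists (3 * B + / (1 - q) + 1).
  assert (HN1 : locally (T := C_UniformSpace) p (fun z : C => Cmod (fst (phi (z, RtoC 0))) < q)).
  { apply (continuous_lt_locally (U := C_UniformSpace)); [exact (Hc1 (RtoC 0))|].
    change (Cmod (fst (phi (p, RtoC 0))) < q). unfold q; lra. }
  assert (HN2 : locally (T := C_UniformSpace) p (fun z : C => Cmod (snd (phi (z, RtoC 0))) < B)).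
  { apply (continuous_lt_locally (U := C_UniformSpace)); [exact (Hc2 (RtoC 0))|].
    change (Cmod (snd (phi (p, RtoC 0))) < B). unfold B; lra. }
  assert (HN3 : locally (T := C_UniformSpace) p (fun z : C => Cmod (snd (phi (z, RtoC 1))) < B)).
  { apply (continuous_lt_locally (U := C_UniformSpace)); [exact (Hc2 (RtoC 1))|].
    change (Cmod (snd (phi (p, RtoC 1))) < B). unfold B; lra. }
  assert (HN4 := continuous_lt_locally (U := C_UniformSpace) (fun z => Cmod z) p 1
    (continuous_Cmod _ _ (continuous_id p)) Hp).
  apply filter_imp with (2 := filter_and _ _ (filter_and _ _ HN1 HN2) (filter_and _ _ HN3 HN4)).
  intros z [[H1 H2] [H3 H4]]. split; [exact H4|]. intros w Hw.
  specialize (Hphi _ Hw). unfold sum_exhaustion in Hphi. simpl snd in Hphi at 1.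
  destruct (Hfib z H4 w) as [E1 E2]. rewrite E1, E2 in Hphi.
  pose proof (Cmod_triangle (snd (phi (z, RtoC 0)))
    ((snd (phi (z, RtoC 1)) - snd (phi (z, RtoC 0))) * w)) as Ht.
  rewrite Cmod_mult in Ht.
  pose proof (Cmod_triangle_minus (snd (phi (z, RtoC 1))) (snd (phi (z, RtoC 0)))) as Ht2.
  pose proof (Cmod_ge_0 w) as Hw0.
  assert (Hi : / (1 - Cmod (fst (phi (z, RtoC 0)))) <= / (1 - q))
    by (apply Rinv_le_contravar; lra).
  assert (Hi0 : 0 < / (1 - q)) by (apply Rinv_0_lt_compat; lra).
  assert (Hlin : Cmod (snd (phi (z, RtoC 1)) - snd (phi (z, RtoC 0))) * Cmod w <= 2 * B * Cmod w)
    by (apply Rmult_le_compat_r; lra).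
  apply Rnot_lt_le. intros Hlt.
  assert (HB : 1 <= B) by (unfold B; lra).
  assert (Cmod w ^ 2 <= B + 2 * B * Cmod w + / (1 - q)) by lra.
  nra.
Qed.

(** Near the vertical line over [p] the set [D] lies in a compact bidisc,
    hence is finite there. *)
Theorem tame_proj1_discrete_fibres_finite (D : C2 -> Prop) : tame disc_times_C D ->
  discrete_in (V := C_NormedModule) unit_disc (proj1_set D) /\
  forall p : C, unit_disc p -> finite_set (fun x : C2 => D x /\ fst x = p).
Proof.
  intros Ht. pose proof (proj1 (proj2 Ht)) as HD.
  assert (Hloc : forall p, unit_disc p -> exists K : C2 -> Prop,
    finite_set (fun x => D x /\ K x) /\
    locally (T := C_UniformSpace) p (fun z : C => forall w : C, D (z, w) -> K (z, w))).
  { intros p Hp. destruct (tame_vertically_bounded D Ht p Hp) as [W HW].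
    set (r := (1 + Cmod p) / 2).
    unfold unit_disc in Hp.
    exists (fun x => Cmod (fst x) <= r /\ Cmod (snd x) <= W). split.
    - apply (discrete_compact_finite (V := C2) disc_times_C D); [exact HD| |].
      + exact (compact_product _ _ (compact_disc r) (compact_disc W)).
      + intros x [Hx _]. apply (Rle_lt_trans _ r); [exact Hx|unfold r; lra].
    - assert (HN : locally (T := C_UniformSpace) p (fun z : C => Cmod z < r)).
      { apply (continuous_lt_locally (U := C_UniformSpace)).
        - apply (continuous_Cmod (U := C_UniformSpace) (fun z => z)), continuous_id.
        - change (Cmod p < r). unfold r. lra. }
      apply filter_imp with (2 := filter_and _ _ HW HN).
      intros z [[_ H1] H2] w Hw. split; [apply Rlt_le, H2|now apply H1]. }
  split; [split|].
  - now intros z [Hz _].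
  - intros p Hp Hacc. destruct (Hloc p Hp) as [K [HK HN]].
    apply finite_set_iff_list in HK. destruct HK as [l Hl].
    assert (Hsep : forall a : C, a <> p -> locally (T := C_UniformSpace) p (fun y => y <> a)).
    { intros a Ha. assert (Hm : 0 < Cmod (a - p)) by (apply Cmod_gt_0; now apply Cminus_eq_contra).
      apply (locally_le_locally_norm (V := C_NormedModule) p).
      exists (mkposreal _ Hm). intros y Hy ->. unfold ball_norm in Hy. simpl in Hy.
      change (Cmod (a - p) < Cmod (a - p)) in Hy. lra. }
    pose proof (locally_avoid_list (V := C_UniformSpace) p (map (fun x : C2 => fst x) l) Hsep) as HN2.
    destruct (Hacc _ (filter_and _ _ HN HN2)) as [y [[H1 H2] [Hyp [_ [w Hw]]]]].
    apply Hyp, H2. change y with (fst ((y, w) : C2)).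
    apply (in_map (fun x : C2 => fst x)). apply Hl. split; [exact Hw|now apply H1].
  - intros p Hp. destruct (Hloc p Hp) as [K [HK HN]].
    apply finite_set_iff_list in HK. destruct HK as [l Hl].
    apply finite_set_iff_list. exists l. intros [z w] [Hx Hz]. simpl in Hz. subst z.
    apply Hl. split; [exact Hx|]. now apply (locally_singleton _ _ HN).
Qed.

(** * Limits of holomorphic functions on the disc *)

Definition radius (n : nat) : R := 1 - / INR (S n).

Lemma INR_S_ge_1 (n : nat) : 1 <= INR (S n).
Proof. rewrite S_INR. pose proof (pos_INR n). lra. Qed.

Lemma radius_bounds (n : nat) : 0 <= radius n < 1.
Proof.
  unfold radius. pose proof (INR_S_ge_1 n) as H.
  assert (0 < / INR (S n)) by (apply Rinv_0_lt_compat; lra).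
  assert (/ INR (S n) <= / 1) by (apply Rinv_le_contravar; lra).
  rewrite Rinv_1 in *. lra.
Qed.

Lemma radius_0 : radius 0 = 0.
Proof. unfold radius. simpl. field. Qed.

Lemma radius_le (m n : nat) : (m <= n)%nat -> radius m <= radius n.
Proof.
  intros H. unfold radius. pose proof (INR_S_ge_1 m).
  assert (/ INR (S n) <= / INR (S m)); [|lra].
  apply Rinv_le_contravar; [lra|]. apply le_INR. lia.
Qed.

Lemma radius_exceeds (x : R) : x < 1 -> exists n, x < radius n.
Proof.
  intros Hx. destruct (archimed_cor1 (1 - x)) as [[|N] [HN HN0]]; [lra|lia|].
  exists N. unfold radius. lra.
Qed.

Lemma radius_annulus (x : R) : 0 < x < 1 -> exists n, radius n < x <= radius (S n).
Proof.
  intros [H0 H1]. destruct (radius_exceeds x H1) as [N HN].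
  assert (H : x <= radius N) by lra. clear HN. induction N as [|N IH].
  - rewrite radius_0 in H. lra.
  - destruct (Rle_lt_dec x (radius N)) as [Hx|Hx]; [now apply IH|]. now exists N.
Qed.

Lemma telescoping_geometric_bound (x : nat -> C) (K : R) (m : nat) :
  (forall n, (m <= n)%nat -> Cmod (x (S n) - x n) <= K * (/ 2) ^ n) ->
  forall n, (m <= n)%nat -> Cmod (x n - x m) <= K * (2 * (/ 2) ^ m - 2 * (/ 2) ^ n).
Proof.
  intros H n Hn. induction Hn as [|n Hn IH].
  - replace (x m - x m)%C with (RtoC 0) by ring. rewrite Cmod_0. lra.
  - replace (x (S n) - x m)%C with ((x (S n) - x n) + (x n - x m))%C by ring.
    eapply Rle_trans; [apply Cmod_triangle|]. specialize (H n Hn). simpl. lra.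
Qed.

Definition tends_to (x : nat -> C) (c : C) : Prop :=
  forall eps, 0 < eps -> exists n0, forall n, (n0 <= n)%nat -> Cmod (x n - c) <= eps.

Lemma tends_to_exists (x : nat -> C) (m : nat) :
  (forall n, (m <= n)%nat -> Cmod (x (S n) - x n) <= (/ 2) ^ n) -> exists c, tends_to x c.
Proof.
  intros H. destruct (dyadic_limit (fun n => x (m + n)%nat) 2) as [c Hc].
  { intros n. replace (m + S n)%nat with (S (m + n)) by lia.
    eapply Rle_trans; [apply H; lia|]. rewrite pow_add. simpl.
    assert ((/ 2) ^ m <= 1) by (rewrite <- (pow1 m); apply pow_incr; lra).
    assert (0 < (/ 2) ^ n) by (apply pow_lt; lra). nra. }
  exists c. intros eps He.
  destruct (pow_lt_1_zero (/ 2) ltac:(rewrite Rabs_right; lra) (eps / 4)) as [N HN]; [lra|].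
  exists (m + N)%nat. intros n Hn. specialize (Hc (n - m)%nat).
  replace (m + (n - m))%nat with n in Hc by lia.
  specialize (HN (n - m)%nat ltac:(lia)). rewrite Rabs_right in HN by (apply Rle_ge, pow_le; lra).
  lra.
Qed.

Lemma tends_to_bound (x : nat -> C) (c a : C) (B : R) (m : nat) :
  tends_to x c -> (forall n, (m <= n)%nat -> Cmod (x n - a) <= B) -> Cmod (c - a) <= B.
Proof.
  intros Hc H. apply le_epsilon. intros eps He.
  destruct (Hc eps He) as [n0 Hn0]. set (n := (n0 + m)%nat).
  specialize (Hn0 n ltac:(unfold n; lia)). specialize (H n ltac:(unfold n; lia)).
  replace (c - a)%C with ((x n - a) - (x n - c))%C by ring.
  eapply Rle_trans; [apply Cmod_triangle_minus|]. lra.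
Qed.

Lemma tends_to_lincomb (x y z : nat -> C) (a b c h : C) :
  tends_to x a -> tends_to y b -> tends_to z c ->
  tends_to (fun n => x n - y n - h * z n)%C (a - b - h * c)%C.
Proof.
  intros Hx Hy Hz eps He. pose proof (Cmod_ge_0 h) as Hh.
  set (e := eps / (2 + Cmod h)).
  assert (He' : 0 < e) by (apply Rdiv_lt_0_compat; lra).
  destruct (Hx e He') as [n1 H1]. destruct (Hy e He') as [n2 H2]. destruct (Hz e He') as [n3 H3].
  exists (n1 + n2 + n3)%nat. intros n Hn.
  specialize (H1 n ltac:(lia)). specialize (H2 n ltac:(lia)). specialize (H3 n ltac:(lia)).
  replace (x n - y n - h * z n - (a - b - h * c))%C
    with ((x n - a) - (y n - b) - h * (z n - c))%C by ring.
  eapply Rle_trans; [apply Cmod_triangle_minus|].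
  pose proof (Cmod_triangle_minus (x n - a) (y n - b)). rewrite Cmod_mult.
  assert (Cmod h * Cmod (z n - c) <= Cmod h * e) by (apply Rmult_le_compat_l; lra).
  replace eps with ((2 + Cmod h) * e) by (unfold e; field; lra). lra.
Qed.

(** The hypothesis on the second-order remainders replaces a uniform bound of
    second derivatives: the remainders of the limit and of [F m] differ by at
    most [2 * |h| ^ 2] near a given point, so the limit is differentiable
    where [F m] is. *)
Lemma weierstrass_limit (F D : nat -> C -> C) :
  (forall n z, Cderiv (F n) z (D n z)) ->
  (forall n z, Cmod z <= radius n -> Cmod (F (S n) z - F n z) <= (/ 2) ^ n) ->
  (forall n z, Cmod z <= radius n -> Cmod (D (S n) z - D n z) <= (/ 2) ^ n) ->
  (forall n z h, Cmod z <= radius n -> Cmod (z + h) <= radius n ->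
    Cmod ((F (S n) (z + h) - F n (z + h)) - (F (S n) z - F n z) - h * (D (S n) z - D n z))%C
      <= Cmod h ^ 2 * (/ 2) ^ n) ->
  exists f : C -> C, (forall z, unit_disc z -> exists l, Cderiv f z l) /\
    forall m z, Cmod z <= radius m -> Cmod (f z - F m z) <= 2 * (/ 2) ^ m.
Proof.
  intros HFD HF HD HR.
  assert (HFlim : forall z, exists c, unit_disc z -> tends_to (fun n => F n z) c).
  { intros z. destruct (classic (unit_disc z)) as [Hz|Hz]; [|exists 0; intros H; now destruct Hz].
    destruct (radius_exceeds _ Hz) as [m Hm].
    destruct (tends_to_exists (fun n => F n z) m) as [c Hc]; [|now exists c].
    intros n Hn. apply HF. pose proof (radius_le m n Hn). lra. }
  assert (HDlim : forall z, unit_disc z -> exists c, tends_to (fun n => D n z) c).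
  { intros z Hz. destruct (radius_exceeds _ Hz) as [m Hm].
    apply (tends_to_exists (fun n => D n z) m).
    intros n Hn. apply HD. pose proof (radius_le m n Hn). lra. }
  set (f := fun z => proj1_sig (constructive_indefinite_description _ (HFlim z))).
  assert (Hf : forall z, unit_disc z -> tends_to (fun n => F n z) (f z)).
  { intros z. exact (proj2_sig (constructive_indefinite_description _ (HFlim z))). }
  exists f. split.
  - intros z Hz. destruct (HDlim z Hz) as [l Hl]. exists l.
    apply Cderiv_iff. intros eps He.
    destruct (radius_exceeds _ Hz) as [m Hm].
    destruct (proj1 (Cderiv_iff _ _ _) (HFD m z) (eps / 2) ltac:(lra)) as [d [Hd HFm]].
    exists (Rmin d (Rmin (radius m - Cmod z) (eps / 4))).
    split; [repeat apply Rmin_pos; lra|]. intros h Hh.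
    pose proof (Rmin_l d (Rmin (radius m - Cmod z) (eps / 4))).
    pose proof (Rmin_r d (Rmin (radius m - Cmod z) (eps / 4))).
    pose proof (Rmin_l (radius m - Cmod z) (eps / 4)).
    pose proof (Rmin_r (radius m - Cmod z) (eps / 4)).
    specialize (HFm h ltac:(lra)).
    pose proof (Cmod_triangle z h) as Hzh. pose proof (radius_bounds m) as Hm1.
    pose proof (Cmod_ge_0 h) as Hh0.
    set (x := fun n => (F n (z + h) - F n z - h * D n z)%C).
    assert (Hx : tends_to x (f (z + h) - f z - h * l)%C).
    { apply (tends_to_lincomb (fun n => F n (z + h)%C) (fun n => F n z) (fun n => D n z));
        [|now apply Hf|exact Hl]. apply Hf. unfold unit_disc. lra. }
    assert (Hxm : Cmod (f (z + h) - f z - h * l - x m)%C <= Cmod h ^ 2 * 2).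
    { apply (tends_to_bound x _ _ _ m Hx). intros n Hn.
      eapply Rle_trans; [apply (telescoping_geometric_bound x (Cmod h ^ 2) m); [|exact Hn]|].
      - intros k Hk. pose proof (radius_le m k Hk).
        replace (x (S k) - x k)%C with ((F (S k) (z + h) - F k (z + h)) - (F (S k) z - F k z)
          - h * (D (S k) z - D k z))%C by (unfold x; ring).
        apply HR; lra.
      - apply Rmult_le_compat_l; [apply pow2_ge_0|].
        assert ((/ 2) ^ m <= 1) by (rewrite <- (pow1 m); apply pow_incr; lra).
        assert (0 < (/ 2) ^ n) by (apply pow_lt; lra). lra. }
    replace (f (z + h) - f z - h * l)%C with ((f (z + h) - f z - h * l - x m) + x m)%C by ring.
    eapply Rle_trans; [apply Cmod_triangle|]. fold (x m) in HFm. nra.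
  - intros m z Hz. assert (Hz1 : unit_disc z).
    { unfold unit_disc. pose proof (radius_bounds m). lra. }
    apply (tends_to_bound _ _ _ _ m (Hf z Hz1)). intros n Hn.
    eapply Rle_trans; [apply (telescoping_geometric_bound (fun n => F n z) 1 m); [|exact Hn]|].
    + intros k Hk. rewrite Rmult_1_l. apply HF. pose proof (radius_le m k Hk). lra.
    + assert (0 < (/ 2) ^ n) by (apply pow_lt; lra). lra.
Qed.

(** * Monomials *)

Lemma Cderiv_pow (k : nat) (z : C) : Cderiv (fun w => w ^ S k)%C z (INR (S k) * z ^ k)%C.
Proof.
  induction k as [|k IH].
  - apply (Cderiv_ext (fun w => w) _ z 1%C); [intros w; simpl; ring|simpl; ring|apply Cderiv_id].
  - apply (Cderiv_ext (fun w => w * w ^ S k)%C _ z (1 * z ^ S k + z * (INR (S k) * z ^ k))%C).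
    + reflexivity.
    + rewrite (S_INR (S k)), RtoC_plus. simpl. ring.
    + apply Cderiv_mult; [apply Cderiv_id|exact IH].
Qed.

(** Induction on [k], from the identity [E (n + 1) = (z + h) * E n + n * z ^
    (n - 1) * h ^ 2] for the remainder [E n] of the [n]-th power. *)
Lemma monomial_remainder (k : nat) (z h : C) (r : R) :
  Cmod z <= r -> Cmod (z + h) <= r ->
  Cmod ((z + h) ^ (k + 2) - z ^ (k + 2) - h * (INR (k + 2) * z ^ (k + 1)))%C
    <= INR (k + 2) ^ 2 * r ^ k * Cmod h ^ 2.
Proof.
  intros Hz Hzh. pose proof (Cmod_ge_0 z) as Hz0. pose proof (Cmod_ge_0 h) as Hh0.
  induction k as [|k IH].
  - replace ((z + h) ^ (0 + 2) - z ^ (0 + 2) - h * (INR (0 + 2) * z ^ (0 + 1)))%C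
      with (h ^ 2)%C.
    2:{ simpl. rewrite RtoC_plus. ring. }
    rewrite Cmod_pow. simpl. nra.
  - set (E := ((z + h) ^ (k + 2) - z ^ (k + 2) - h * (INR (k + 2) * z ^ (k + 1)))%C) in *.
    set (N := INR (k + 2)) in *.
    assert (HN : 0 <= N) by apply pos_INR.
    replace (INR (S k + 2)) with (N + 1) by (unfold N; rewrite <- S_INR; f_equal; lia).
    replace (S k + 1)%nat with (S (k + 1)) by lia. replace (S k + 2)%nat with (S (k + 2)) by lia.
    replace ((z + h) ^ S (k + 2) - z ^ S (k + 2) - h * ((N + 1)%R * z ^ S (k + 1)))%C
      with ((z + h) * E + h ^ 2 * (N * z ^ (k + 1)))%C.
    2:{ unfold E. replace (k + 2)%nat with (S (k + 1)) by lia. rewrite RtoC_plus. simpl. ring. }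
    eapply Rle_trans; [apply Cmod_triangle|].
    rewrite !Cmod_mult, !Cmod_pow, Cmod_R, Rabs_right by lra.
    assert (Hr : 0 <= r) by lra.
    assert (H1 : Cmod (z + h) * Cmod E <= r * (N ^ 2 * r ^ k * Cmod h ^ 2))
      by (apply Rmult_le_compat; try apply Cmod_ge_0; assumption).
    assert (H2 : Cmod z ^ (k + 1) <= r ^ (k + 1)) by (apply pow_incr; lra).
    assert (H3 : Cmod h ^ 2 * (N * Cmod z ^ (k + 1)) <= Cmod h ^ 2 * (N * r ^ (k + 1))).
    { apply Rmult_le_compat_l; [apply pow2_ge_0|]. now apply Rmult_le_compat_l. }
    replace (k + 1)%nat with (S k) in H3 by lia. simpl (r ^ S k) in *.
    assert (H4 : 0 <= r * r ^ k * Cmod h ^ 2).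
    { apply Rmult_le_pos; [|apply pow2_ge_0]. apply Rmult_le_pos; [lra|now apply pow_le]. }
    replace (k + 1)%nat with (S k) by lia.
    apply Rle_trans with ((N ^ 2 + N) * (r * r ^ k * Cmod h ^ 2)); [lra|].
    replace ((N + 1) ^ 2 * (r * r ^ k) * Cmod h ^ 2) with ((N + 1) ^ 2 * (r * r ^ k * Cmod h ^ 2)) by ring.
    apply Rmult_le_compat_r; [exact H4|]. nra.
Qed.

Lemma linear_times_geom (p : R) (n : nat) : 0 <= p < 1 -> (1 - p) * (INR n * p ^ n) <= 1 - p ^ n.
Proof.
  intros Hp. induction n as [|n IH].
  - simpl. lra.
  - rewrite S_INR. simpl.
    assert (0 <= p ^ n <= 1) by (split; [apply pow_le; lra|rewrite <- (pow1 n); apply pow_incr; lra]).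
    assert (p * ((1 - p) * (INR n * p ^ n)) <= p * (1 - p ^ n)) by (apply Rmult_le_compat_l; lra).
    assert (0 <= (1 - p) * (1 - p * p ^ n)) by (apply Rmult_le_pos; nra).
    nra.
Qed.

(** With [p] the fourth root of [q], the sequence [k * p ^ k] is bounded, so
    that [k ^ 2 * q ^ k = (k * p ^ k) ^ 2 * p ^ (2 * k)] tends to [0]. *)
Lemma quadratic_times_geom (q eps : R) : 0 <= q < 1 -> 0 < eps ->
  exists k, (1 <= k)%nat /\ INR (k + 2) ^ 2 * q ^ k <= eps.
Proof.
  intros Hq He. set (p := sqrt (sqrt q)).
  assert (Hs : sqrt q < 1) by (rewrite <- sqrt_1; apply sqrt_lt_1; lra).
  assert (Hp1 : p < 1).
  { unfold p. rewrite <- sqrt_1. apply sqrt_lt_1; [apply sqrt_pos|lra|exact Hs]. }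
  assert (Hp0 : 0 <= p) by apply sqrt_pos.
  assert (Hpq : q = p ^ 2 * p ^ 2).
  { unfold p. rewrite pow2_sqrt by apply sqrt_pos. symmetry. apply sqrt_sqrt. lra. }
  set (c := / (1 - p)). assert (Hc : 0 < c) by (apply Rinv_0_lt_compat; lra).
  destruct (pow_lt_1_zero p ltac:(rewrite Rabs_right; lra) (eps / (9 * c ^ 2))) as [N HN].
  { apply Rdiv_lt_0_compat; [exact He|]. nra. }
  set (k := S N). exists k. split; [unfold k; lia|].
  specialize (HN k ltac:(unfold k; lia)).
  assert (Hpk : 0 <= p ^ k <= 1)
    by (split; [apply pow_le; lra|rewrite <- (pow1 k); apply pow_incr; lra]).
  rewrite Rabs_right in HN by lra. apply Rlt_div_r in HN; [|nra].
  assert (Hk : INR (k + 2) <= 3 * INR k).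
  { rewrite plus_INR. simpl (INR 2). unfold k. pose proof (INR_S_ge_1 N). lra. }
  assert (Hg : INR k * p ^ k <= c).
  { pose proof (linear_times_geom p k (conj Hp0 Hp1)) as H.
    apply Rmult_le_reg_l with (1 - p); [lra|]. unfold c. rewrite Rinv_r; lra. }
  pose proof (pos_INR k) as Hk0. pose proof (pos_INR (k + 2)) as Hk2.
  rewrite Hpq, Rpow_mult_distr, <- !pow_mult, Nat.mul_comm, !pow_mult.
  set (x := p ^ k) in *. set (y := INR k) in *.
  assert (H1 : INR (k + 2) ^ 2 <= (3 * y) ^ 2) by (apply pow_incr; lra).
  assert (H2 : (y * x) ^ 2 <= c ^ 2) by (apply pow_incr; nra).
  apply Rle_trans with ((3 * y) ^ 2 * (x ^ 2 * x ^ 2)).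
  { apply Rmult_le_compat_r; [|exact H1]. apply Rmult_le_pos; apply pow2_ge_0. }
  replace ((3 * y) ^ 2 * (x ^ 2 * x ^ 2)) with (9 * (y * x) ^ 2 * x ^ 2) by ring.
  apply Rle_trans with (9 * c ^ 2 * x ^ 2).
  { apply Rmult_le_compat_r; [apply pow2_ge_0|lra]. }
  apply Rle_trans with (9 * c ^ 2 * x); [|lra].
  apply Rmult_le_compat_l; [nra|]. nra.
Qed.

(** * A holomorphic function that is large on a discrete set *)

Lemma list_upper_bound {T : Type} (g : T -> R) (l : list T) :
  exists B, forall x, In x l -> g x <= B.
Proof.
  induction l as [|a l [B HB]].
  - exists 0. intros x [].
  - exists (Rmax (g a) B). intros x [<-|Hx]; [apply Rmax_l|].
    eapply Rle_trans; [now apply HB|apply Rmax_r].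
Qed.

Lemma list_gap (l : list C) (r : R) :
  exists rho, r < rho /\ forall s, In s l -> r < Cmod s -> rho <= Cmod s.
Proof.
  induction l as [|a l [rho [Hr H]]].
  - exists (r + 1). split; [lra|]. intros s [].
  - destruct (Rlt_le_dec r (Cmod a)) as [Ha|Ha].
    + exists (Rmin rho (Cmod a)). split; [now apply Rmin_glb_lt|].
      intros s [<-|Hs] Hrs; [apply Rmin_r|].
      eapply Rle_trans; [apply Rmin_l|now apply H].
    + exists rho. split; [exact Hr|]. intros s [<-|Hs] Hrs; [lra|now apply H].
Qed.

(** The monomial [c * (z / rho) ^ (k + 2)] has modulus at least [c] wherever
    [|z| >= rho]. With [rho > r] a lower bound for the moduli of the points to
    be treated, a large exponent makes it and its first two derivatives small
    for [|z| <= r]. *)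
Lemma peak_monomial (l : list C) (B r eps : R) : 0 <= r -> 0 < eps ->
  exists (a : R) (k : nat), 0 <= a /\ (1 <= k)%nat /\ a * (INR (k + 2) ^ 2 * r ^ k) <= eps /\
    forall s, In s l -> r < Cmod s -> B <= a * Cmod s ^ (k + 2).
Proof.
  intros Hr He. destruct (list_gap l r) as [rho [Hrho Hl]].
  set (c := Rmax B 0). assert (Hc : 0 <= c) by apply Rmax_r.
  assert (Hq : 0 <= r / rho < 1).
  { split; [apply Rdiv_le_0_compat; lra|]. apply Rlt_div_l; lra. }
  assert (Hrho2 : 0 < rho ^ 2) by (apply pow_lt; lra).
  destruct (quadratic_times_geom (r / rho) (eps * rho ^ 2 / (c + 1)) Hq) as [k [Hk1 Hk]].
  { apply Rdiv_lt_0_compat; [now apply Rmult_lt_0_compat|lra]. }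
  assert (Hrhok : 0 < rho ^ k) by (apply pow_lt; lra).
  exists (c / rho ^ (k + 2)), k.
  assert (Hpk : 0 < rho ^ (k + 2)) by (apply pow_lt; lra).
  repeat split.
  - now apply Rdiv_le_0_compat.
  - exact Hk1.
  - replace (c / rho ^ (k + 2) * (INR (k + 2) ^ 2 * r ^ k))
      with (c / rho ^ 2 * (INR (k + 2) ^ 2 * (r / rho) ^ k)).
    2:{ unfold Rdiv. rewrite Rpow_mult_distr, pow_inv, pow_add. field. lra. }
    eapply Rle_trans.
    { apply Rmult_le_compat_l; [|exact Hk]. apply Rdiv_le_0_compat; lra. }
    replace (c / rho ^ 2 * (eps * rho ^ 2 / (c + 1))) with (eps * (c / (c + 1)))
      by (field; split; lra).
    rewrite <- (Rmult_1_r eps) at 2. apply Rmult_le_compat_l; [lra|]. apply Rle_div_l; lra.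
  - intros s Hs Hrs. pose proof (Hl s Hs Hrs) as H.
    apply Rle_trans with c; [apply Rmax_l|].
    replace (c / rho ^ (k + 2) * Cmod s ^ (k + 2))
      with (c * (Cmod s ^ (k + 2) / rho ^ (k + 2))) by (field; lra).
    rewrite <- (Rmult_1_r c) at 1. apply Rmult_le_compat_l; [exact Hc|].
    apply Rle_div_r; [exact Hpk|]. rewrite Rmult_1_l. apply pow_incr. lra.
Qed.

Lemma discrete_in_smaller_disc_list (S : C -> Prop) (r : R) :
  discrete_in (V := C_NormedModule) unit_disc S -> r < 1 ->
  exists l, forall s, S s -> Cmod s <= r -> In s l.
Proof.
  intros HS Hr.
  assert (H := discrete_compact_finite (V := C_UniformSpace) unit_disc S (fun z => Cmod z <= r)
    HS (compact_disc r) (fun x Hx => Rle_lt_trans _ _ _ Hx Hr)).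
  apply finite_set_iff_list in H. destruct H as [l Hl]. exists l. intros s H1 H2.
  now apply Hl.
Qed.

(** One quantity dominates the modulus of the monomial, that of its derivative
    and its second-order remainder. *)
Lemma monomial_derivative_bounds (r x N : R) (k : nat) : 0 <= x <= r -> r < 1 -> 1 <= N ->
  x ^ (k + 2) <= N ^ 2 * r ^ k /\ N * x ^ (k + 1) <= N ^ 2 * r ^ k.
Proof.
  intros Hx Hr HN.
  assert (H : x ^ k <= r ^ k) by (apply pow_incr; lra).
  assert (H0 : 0 <= x ^ k) by (apply pow_le; lra).
  rewrite !pow_add. simpl. rewrite !Rmult_1_r.
  assert (x * x <= 1 * 1) by (apply Rmult_le_compat; lra).
  assert (x ^ k * (x * x) <= x ^ k * 1) by (apply Rmult_le_compat_l; lra).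
  assert (x ^ k * x <= x ^ k * 1) by (apply Rmult_le_compat_l; lra).
  assert (1 * 1 <= N * N) by (apply Rmult_le_compat; lra).
  assert (1 * r ^ k <= N * N * r ^ k) by (apply Rmult_le_compat_r; lra).
  split; [lra|].
  assert (N * (x ^ k * x) <= N * (r ^ k)) by (apply Rmult_le_compat_l; lra).
  assert (1 * (N * r ^ k) <= N * (N * r ^ k)) by (apply Rmult_le_compat_r; [nra|lra]).
  lra.
Qed.

(** Add monomials one at a time. In step [n] only finitely many points of [S]
    lie in the annulus [radius n < |z| <= radius (n + 1)], and a monomial that
    is small on [|z| <= radius n] makes the sum large at all of them; later
    monomials change these values by at most [1]. *)
Theorem holomorphic_large_on_discrete (S : C -> Prop) (M : C -> R) :
  discrete_in (V := C_NormedModule) unit_disc S ->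
  exists f : C -> C, (forall z, unit_disc z -> exists l, Cderiv f z l) /\
    forall s, S s -> M s <= Cmod (f s).
Proof.
  intros HS.
  assert (Hstep : forall (n : nat) (F : C -> C), exists ak : R * nat,
    0 <= fst ak /\ (1 <= snd ak)%nat /\
    fst ak * (INR (snd ak + 2) ^ 2 * radius n ^ snd ak) <= (/ 2) ^ n /\
    forall s, S s -> radius n < Cmod s <= radius (Datatypes.S n) ->
      M s + 1 + Cmod (F s) <= fst ak * Cmod s ^ (snd ak + 2)).
  { intros n F.
    destruct (discrete_in_smaller_disc_list S (radius (Datatypes.S n)) HS) as [l Hl];
      [apply radius_bounds|].
    destruct (list_upper_bound (fun s => M s + 1 + Cmod (F s)) l) as [B HB].
    destruct (peak_monomial l B (radius n) ((/ 2) ^ n)) as [a [k [Ha [Hk [Hak Hs]]]]];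
      [apply radius_bounds|apply pow_lt; lra|].
    exists (a, k). simpl. repeat split; try assumption. intros s HSs [H1 H2].
    pose proof (Hl s HSs H2) as Hin. eapply Rle_trans; [now apply HB|now apply Hs]. }
  set (ak := fun n F => proj1_sig (constructive_indefinite_description _ (Hstep n F))).
  assert (Hak : forall n F, 0 <= fst (ak n F) /\ (1 <= snd (ak n F))%nat /\
    fst (ak n F) * (INR (snd (ak n F) + 2) ^ 2 * radius n ^ snd (ak n F)) <= (/ 2) ^ n /\
    forall s, S s -> radius n < Cmod s <= radius (Datatypes.S n) ->
      M s + 1 + Cmod (F s) <= fst (ak n F) * Cmod s ^ (snd (ak n F) + 2)).
  { intros n F. exact (proj2_sig (constructive_indefinite_description _ (Hstep n F))). }
  clearbody ak. clear Hstep.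
  (* The constant term treats the point [0], which lies in no annulus; [2] is
     the error allowed by [weierstrass_limit] for [m = 0]. *)
  set (F := fix F n : C -> C := match n with
    | O => fun _ => RtoC (Rabs (M 0) + 2)
    | Datatypes.S m => fun z => (F m z + fst (ak m (F m)) * z ^ (snd (ak m (F m)) + 2))%C
    end).
  set (a := fun n => fst (ak n (F n))). set (k := fun n => snd (ak n (F n))).
  set (N := fun n => INR (k n + 2)).
  assert (Ha : forall n, 0 <= a n) by (intros n; apply Hak).
  assert (Hak' : forall n, a n * (N n ^ 2 * radius n ^ k n) <= (/ 2) ^ n) by (intros n; apply Hak).
  assert (Hbig : forall n s, S s -> radius n < Cmod s <= radius (Datatypes.S n) ->
    M s + 1 + Cmod (F n s) <= a n * Cmod s ^ (k n + 2)) by (intros n; apply Hak).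
  assert (HFS : forall n z, F (Datatypes.S n) z = (F n z + a n * z ^ (k n + 2))%C) by reflexivity.
  set (D := fix D n (z : C) : C := match n with
    | O => RtoC 0
    | Datatypes.S m => (D m z + a m * (N m * z ^ (k m + 1)))%C
    end).
  assert (HDS : forall n z, D (Datatypes.S n) z = (D n z + a n * (N n * z ^ (k n + 1)))%C)
    by reflexivity.
  assert (HN : forall n, 1 <= N n).
  { intros n. unfold N. rewrite plus_INR. pose proof (pos_INR (k n)). simpl. lra. }
  destruct (weierstrass_limit F D) as [f [Hf HfF]].
  - induction n as [|n IH]; intros z; [apply Cderiv_const|].
    apply (Cderiv_plus (F n) (fun z => a n * z ^ (k n + 2))%C z (D n z)); [apply IH|].
    apply (Cderiv_ext (fun z => a n * z ^ (k n + 2))%C _ z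
      (0 * z ^ (k n + 2) + a n * (N n * z ^ (k n + 1)))%C); [reflexivity|ring|].
    apply (Cderiv_mult (fun _ => RtoC (a n)) (fun z => z ^ (k n + 2))%C); [apply Cderiv_const|].
    unfold N. replace (k n + 2)%nat with (Datatypes.S (k n + 1)) by lia. apply Cderiv_pow.
  - intros n z Hz. rewrite HFS.
    replace (F n z + a n * z ^ (k n + 2) - F n z)%C with (a n * z ^ (k n + 2))%C by ring.
    rewrite Cmod_mult, Cmod_pow, Cmod_R, Rabs_right by (apply Rle_ge, Ha).
    eapply Rle_trans; [|apply (Hak' n)]. apply Rmult_le_compat_l; [apply Ha|].
    apply monomial_derivative_bounds; [split; [apply Cmod_ge_0|exact Hz]|apply radius_bounds|apply HN].
  - intros n z Hz. rewrite HDS.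
    replace (D n z + a n * (N n * z ^ (k n + 1)) - D n z)%C
      with (a n * (N n * z ^ (k n + 1)))%C by ring.
    pose proof (HN n).
    rewrite !Cmod_mult, Cmod_pow, !Cmod_R, !Rabs_right by (try apply Rle_ge, Ha; lra).
    eapply Rle_trans; [|apply (Hak' n)]. apply Rmult_le_compat_l; [apply Ha|].
    apply monomial_derivative_bounds; [split; [apply Cmod_ge_0|exact Hz]|apply radius_bounds|apply HN].
  - intros n z h Hz Hzh. rewrite !HFS, HDS.
    replace (F n (z + h) + a n * (z + h) ^ (k n + 2) - F n (z + h) -
      (F n z + a n * z ^ (k n + 2) - F n z) -
      h * (D n z + a n * (N n * z ^ (k n + 1)) - D n z))%C
      with (a n * ((z + h) ^ (k n + 2) - z ^ (k n + 2) - h * (N n * z ^ (k n + 1))))%C by ring.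
    rewrite Cmod_mult, Cmod_R, Rabs_right by (apply Rle_ge, Ha).
    eapply Rle_trans.
    { apply Rmult_le_compat_l; [apply Ha|]. exact (monomial_remainder (k n) z h (radius n) Hz Hzh). }
    fold (N n).
    replace (a n * (N n ^ 2 * radius n ^ k n * Cmod h ^ 2))
      with (Cmod h ^ 2 * (a n * (N n ^ 2 * radius n ^ k n))) by ring.
    apply Rmult_le_compat_l; [apply pow2_ge_0|apply Hak'].
  - exists f. split; [exact Hf|]. intros s Hs.
    assert (Hs1 : Cmod s < 1) by now apply HS.
    destruct (Ceq_dec s 0) as [->|Hs0].
    + assert (H0 : Cmod (RtoC 0) <= radius 0) by (rewrite Cmod_0, radius_0; lra).
      pose proof (HfF 0%nat 0 H0) as H. simpl F in H.
      pose proof (Cmod_triangle_inv (RtoC (Rabs (M 0) + 2)) (f 0 - RtoC (Rabs (M 0) + 2))) as Ht.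
      replace (RtoC (Rabs (M 0) + 2) + (f 0 - RtoC (Rabs (M 0) + 2)))%C with (f 0) in Ht by ring.
      rewrite Cmod_R, (Rabs_right (Rabs (M 0) + 2)) in Ht
        by (pose proof (Rabs_pos (M 0)); lra).
      pose proof (Rle_abs (M 0)). simpl in H. lra.
    + apply Cmod_gt_0 in Hs0. destruct (radius_annulus (Cmod s) (conj Hs0 Hs1)) as [n Hn].
      pose proof (HfF (Datatypes.S n) s (proj2 Hn)) as H.
      pose proof (Hbig n s Hs Hn) as Hb.
      pose proof (Cmod_triangle_inv (F (Datatypes.S n) s) (f s - F (Datatypes.S n) s)) as Ht.
      replace (F (Datatypes.S n) s + (f s - F (Datatypes.S n) s))%C with (f s) in Ht by ring.
      pose proof (Cmod_triangle_inv (a n * s ^ (k n + 2)) (F n s)) as Ht2.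
      rewrite Cmod_mult, Cmod_pow, Cmod_R, (Rabs_right (a n)) in Ht2 by (apply Rle_ge, Ha).
      rewrite (Cplus_comm (a n * s ^ (k n + 2))%C), <- HFS in Ht2.
      assert ((/ 2) ^ n <= 1) by (rewrite <- (pow1 n); apply pow_incr; lra).
      simpl ((/ 2) ^ Datatypes.S n) in H. lra.
Qed.

(** * Sufficiency *)

(** Sublevel sets are compact, hence vertically bounded. *)
Lemma exhaustion_vertical (rho : C2 -> R) (z : C) (m : R) :
  exhaustion disc_times_C rho -> unit_disc z ->
  exists W, forall w, W <= Cmod w -> m <= rho (z, w).
Proof.
  intros [_ [_ Hc]] Hz.
  destruct (Hc m nat (fun n x => Cmod (snd x) < INR n)) as [l Hl].
  - intros n. apply (open_comp (fun x : C2 => Cmod (snd x)) (fun u => u < INR n)).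
    + intros x _. apply continuous_Cmod_snd.
    + apply open_lt.
  - intros x _. destruct (INR_unbounded (Cmod (snd x))) as [n Hn]. now exists n.
  - destruct (list_upper_bound INR l) as [B HB]. exists B. intros w Hw.
    apply Rnot_lt_le. intros Hlt.
    destruct (Hl (z, w)) as [n [Hn Hwn]]; [split; [exact Hz|lra]|].
    specialize (HB n Hn). simpl in Hwn. lra.
Qed.

(** The linear part at [x] is [(a, b) |-> (a, b + a * l)], where [l] is the
    derivative of [f]; only the second coordinate has a remainder. *)
Lemma shear_holomorphic (f : C -> C) :
  (forall z, unit_disc z -> exists l, Cderiv f z l) ->
  holomorphic_on (V := C2) (W := C2) disc_times_C (fun x => (fst x, (snd x + f (fst x))%C)).
Proof.
  intros Hf x Hx. destruct (Hf (fst x) Hx) as [l Hl].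
  set (L := fun h : C2 => ((fst h, (snd h + fst h * l)%C) : C2)). exists L.
  assert (Hlin : is_linear L).
  { apply (is_linear_prod (T := C2) (U := C_NormedModule) (V := C_NormedModule)).
    - apply is_linear_fst.
    - split.
      + intros [a b] [c d]. change (b + d + (a + c) * l = (b + a * l) + (d + c * l))%C. ring.
      + intros t [a b]. change (t * b + t * a * l = t * (b + a * l))%C. ring.
      + pose proof (Cmod_ge_0 l) as Hl0. exists (1 + Cmod l). split; [lra|]. intros h.
        destruct (Cmod_coordinates_le_norm h) as [H1 H2].
        change (Cmod (snd h + fst h * l) <= (1 + Cmod l) * norm h).
        eapply Rle_trans; [apply Cmod_triangle|]. rewrite Cmod_mult.
        assert (Cmod (fst h) * Cmod l <= norm h * Cmod l) by (apply Rmult_le_compat_r; lra).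
        lra. }
  apply (filterdiff_locally_iff (K := C_AbsRing) (U := C2) (V := C2) _ _ _ Hlin).
  intros eps He. destruct (proj1 (Cderiv_iff _ _ _) Hl eps He) as [d [Hd H]].
  exists d. split; [exact Hd|]. intros y Hy.
  set (h := minus y x) in *. destruct (Cmod_coordinates_le_norm h) as [H1 _].
  specialize (H (fst h) (Rle_lt_trans _ _ _ H1 Hy)).
  match goal with |- norm ?e <= _ =>
    replace e with ((RtoC 0, (f (fst x + fst h) - f (fst x) - fst h * l)%C) : C2) end.
  - rewrite norm_C2_vertical. eapply Rle_trans; [exact H|]. apply Rmult_le_compat_l; lra.
  - destruct x as [x1 x2], y as [y1 y2].
    change (fst h) with (y1 - x1)%C. apply injective_projections; simpl.
    + change (RtoC 0 = (y1 - x1) - (y1 - x1))%C. ring.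
    + change (f (x1 + (y1 - x1)) - f x1 - (y1 - x1) * l
        = (y2 + f y1) - (x2 + f x1) - ((y2 - x2) + (y1 - x1) * l))%C.
      assert (E : @eq C (x1 + (y1 - x1))%C y1) by ring. rewrite E. ring.
Qed.

Lemma shear_automorphism (f : C -> C) :
  (forall z, unit_disc z -> exists l, Cderiv f z l) ->
  automorphism (V := C2) disc_times_C (fun x => (fst x, (snd x + f (fst x))%C)).
Proof.
  intros Hf. split; [|split].
  - intros x Hx. exact Hx.
  - now apply shear_holomorphic.
  - exists (fun x => (fst x, (snd x + - f (fst x))%C)). split; [|split; [|split]].
    + intros x Hx. exact Hx.
    + apply (shear_holomorphic (fun z => - f z)%C). intros z Hz. destruct (Hf z Hz) as [l Hl].
      eexists. apply (Cderiv_comp Copp f); [apply Cderiv_opp_id|exact Hl].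
    + intros [z w] _. apply injective_projections; [reflexivity|].
      change (w + f z + - f z = w)%C. ring.
    + intros [z w] _. apply injective_projections; [reflexivity|].
      change (w + - f z + f z = w)%C. ring.
Qed.

(** On each vertical line that meets [D] only finitely many inequalities are
    required, and they hold as soon as the translation of that line is large
    enough. A shear by a function that is large on the projection of [D] does
    this on all lines at once. *)
Theorem proj1_discrete_fibres_finite_tame (D : C2 -> Prop) :
  ~ finite_set D -> discrete_in disc_times_C D ->
  discrete_in (V := C_NormedModule) unit_disc (proj1_set D) ->
  (forall p : C, unit_disc p -> finite_set (fun x : C2 => D x /\ fst x = p)) ->
  tame disc_times_C D.
Proof.
  intros Hinf HD Hproj Hfib. split; [exact Hinf|split; [exact HD|]].
  intros rho Hrho zeta _.
  assert (HM : forall z : C, exists M, unit_disc z -> forall c : C, M <= Cmod c ->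
    forall w : C, D (z, w) -> zeta (z, w) <= rho (z, (w + c)%C)).
  { intros z. destruct (classic (unit_disc z)) as [Hz|Hz]; [|exists 0; intros H; now destruct Hz].
    destruct (proj1 (finite_set_iff_list _) (Hfib z Hz)) as [l Hl].
    destruct (list_upper_bound zeta l) as [m Hm].
    destruct (list_upper_bound (fun x : C2 => Cmod (snd x)) l) as [B HB].
    destruct (exhaustion_vertical rho z m Hrho Hz) as [W HW].
    exists (W + B). intros _ c Hc w Hw.
    assert (Hin : In ((z, w) : C2) l) by (apply Hl; now split).
    eapply Rle_trans; [apply Hm, Hin|]. apply HW.
    pose proof (HB _ Hin) as HBw. simpl in HBw.
    pose proof (Cmod_triangle_inv c w) as Ht. rewrite Cplus_comm in Ht. lra. }
  set (M := fun z => proj1_sig (constructive_indefinite_description _ (HM z))).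
  destruct (holomorphic_large_on_discrete (proj1_set D) M Hproj) as [f [Hf HfM]].
  exists (fun x => (fst x, (snd x + f (fst x))%C)). split; [now apply shear_automorphism|].
  intros [z w] Hx.
  assert (Hz : unit_disc z) by exact (proj1 HD _ Hx).
  apply (proj2_sig (constructive_indefinite_description _ (HM z)) Hz); [|exact Hx].
  apply HfM. split; [exact Hz|]. now exists w.
Qed.

Theorem proposition5p1 (D : C2 -> Prop)
    (D_infinite : ~ finite_set D)
    (D_discrete : discrete_in disc_times_C D) :
  tame disc_times_C D <->
  (discrete_in (V := C_NormedModule) unit_disc (proj1_set D) /\
   forall p : C, unit_disc p -> finite_set (fun x : C2 => D x /\ fst x = p)).
Proof.
  split.
  - apply tame_proj1_discrete_fibres_finite.
  - intros [Hproj Hfib]. now apply proj1_discrete_fibres_finite_tame.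
Qed.
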